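(* Let $\mathcal H\subset\mathbb{R}^N$ be a basic spectratope $$\mathcal H=\{g\in\mathbb{R}^N:\ \exists r\in\mathcal R:\ S_i^2[g]\preceq r_iI_{d_i},\ i\le I\},$$ with spectratopic data $\mathcal R$ and $S_i[\cdot]$, $i\le I$. Consider the closed convex cone $$\mathbf K=\{(\Sigma,\rho)\in\mathbf S^N_+\times\mathbb{R}_+:\ \exists r\in\mathcal R:\ \mathcal S_i[\Sigma]\preceq\rho\,r_iI_{d_i},\ i\le I\}.$$ Then: (i) whenever $\Sigma=\sum_j\lambda_jg_jg_j^T$ (a finite sum) with $\lambda_j\ge0$ and $g_j\in\mathcal H$ for all $j$, we have $\big(\Sigma,\sum_j\lambda_j\big)\in\mathbf K$; (ii) and ''nearly'' vice versa: whenever $(\Sigma,\rho)\in\mathbf K$, there exist (and can be found efficiently by a randomized algorithm) $\lambda_j\ge0$ and $g_j$, $j\le N$, such that $$\Sigma=\sum_{j=1}^N\lambda_jg_jg_j^T\quad\text{with}\quad\sum_{j=1}^N\lambda_j\le\varkappa\rho\quad\text{and}\quad g_j\in\mathcal H,\ j\le N,$$ where $\varkappa=4\ln(4DN)$, $D=\sum_{i\le I}d_i$.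
   Context: $\mathbf S^d$ is the space of symmetric $d\times d$ real matrices, $\mathbf S^d_+$ its positive semidefinite cone, $\preceq$ the semidefinite order. Spectratopic data: symmetric matrices $S^{ij}\in\mathbf S^{d_i}$, $1\le i\le I$, $1\le j\le N$, with $S_i[g]=\sum_{j=1}^Ng_jS^{ij}$ for $g\in\mathbb{R}^N$, and $S_i^2[g]=(S_i[g])^2$; the data are nondegenerate, meaning that for every $g\ne0$ at least one of the matrices $S_i[g]$, $i\le I$, is nonzero; $\mathcal R\subset\mathbb{R}^I_+$ is a compact convex set with nonempty interior which is monotone ($0\le r'\le r\in\mathcal R$ implies $r'\in\mathcal R$). A set $\mathcal H\subset\mathbb{R}^N$ of the form $\{g\in\mathbb{R}^N:\ \exists r\in\mathcal R:\ S_i^2[g]\preceq r_iI_{d_i},\ i\le I\}$, with such data $\mathcal R$ and $S_i[\cdot]$, $i\le I$, is called a basic spectratope. Associated linear mappings: $\mathcal S_i[G]=\sum_{p,q=1}^NG_{pq}S^{ip}S^{iq}:\mathbf S^N\to\mathbf S^{d_i}$. *)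

(* Defs.v *)
From HB Require Import structures.
From mathcomp Require Import all_boot all_order all_algebra.
From mathcomp Require Import sesquilinear.
From mathcomp Require Import all_classical all_reals all_analysis.

Set Implicit Arguments.
Unset Strict Implicit.
Unset Printing Implicit Defensive.

Import Order.TTheory GRing.Theory Num.Theory.
Import numFieldNormedType.Exports.

Local Open Scope classical_set_scope.
Local Open Scope ring_scope.

Section Spectratopes.
Variable R : realType.

Definition psd (n : nat) (A : 'M[R]_n) : Prop :=
  A \is symmetricmx /\ forall x : 'cV[R]_n, 0 <= (x^T *m A *m x) 0 0.

Definition loewner_le (n : nat) (A B : 'M[R]_n) : Prop := psd (B - A).

Section Data.
Variables (I N : nat) (d : 'I_I -> nat).
(* [Rs] is the set of vectors r in R^I, the matrices S^{ij} are [S i j]. *)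
Variables (Rs : set 'rV[R]_I) (S : forall i : 'I_I, 'I_N -> 'M[R]_(d i)).

Definition Slin (i : 'I_I) (g : 'cV[R]_N) : 'M[R]_(d i) :=
  \sum_(j < N) g j 0 *: S i j.

Definition Squad (i : 'I_I) (G : 'M[R]_N) : 'M[R]_(d i) :=
  \sum_(p < N) \sum_(q < N) G p q *: (S i p *m S i q).

Record spectratopic_data : Prop := SpectratopicData {
  data_sym : forall i j, S i j \is symmetricmx;
  data_nondegenerate : forall g : 'cV[R]_N, g != 0 -> exists i, Slin i g != 0;
  data_nonneg : forall r, Rs r -> forall i, 0 <= r 0 i;
  data_compact : compact Rs;
  data_convex : @convex_set R 'rV[R]_I Rs;
  data_interior : (interior Rs) !=set0;
  data_monotone : forall r r' : 'rV[R]_I, Rs r ->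
    (forall i, 0 <= r' 0 i <= r 0 i) -> Rs r'
}.

Definition spectratope : set 'cV[R]_N :=
  [set g | exists2 r, Rs r &
     forall i, loewner_le (Slin i g *m Slin i g) (r 0 i)%:M].

Definition spectratope_cone : set ('M[R]_N * R^o) :=
  [set p | [/\ psd p.1, 0 <= p.2 &
     exists2 r, Rs r &
       forall i, loewner_le (Squad i p.1) (p.2 * r 0 i)%:M]].

Definition total_dim : nat := (\sum_(i < I) d i)%N.

Definition kappa : R := 4 * ln (4 * total_dim%:R * N%:R).

End Data.

Definition closed_convex_cone (N : nat) (K : set ('M[R]_N * R^o)) : Prop :=
  [/\ closed K, @convex_set R ('M[R]_N * R^o)%type K, K !=set0 &
      forall (t : R) p, 0 <= t -> K p -> K (t *: p)].

(* Sigma = sum_{j <= N} lambda_j g_j g_j^T with nonnegative weights of total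
   mass at most [b] and with all g_j in [H]. *)
Definition decomposes (N : nat) (H : set 'cV[R]_N) (Sigma : 'M[R]_N) (b : R)
    (lambda : 'I_N -> R) (g : 'I_N -> 'cV[R]_N) : Prop :=
  [/\ forall j, 0 <= lambda j,
      Sigma = \sum_(j < N) lambda j *: (g j *m (g j)^T),
      \sum_(j < N) lambda j <= b &
      forall j, H (g j)].

End Spectratopes.

(* Model of computation for "can be found efficiently by a randomized
   algorithm": exact real arithmetic (a real RAM), unit cost per operation, and
   a tape of independent fair bits.  The algorithm is one finite program, the
   same for all sizes and all data.  Arrays of reals are doubly indexed and
   named by natural numbers.  Index variables hold the input sizes and the loop
   counters, so that every loop is bounded. *)

Inductive iexp : Type :=
| IVar of nat
| INum of nat
| IAdd of iexp & iexp
| IMul of iexp & iexp.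

Inductive rexp : Type :=
| RLoad of nat & iexp & iexp
| RNat of iexp
| RBit of iexp
| RPi
| RAdd of rexp & rexp
| RSub of rexp & rexp
| RMul of rexp & rexp
| RDiv of rexp & rexp
| RSqrt of rexp
| RLn of rexp
| RCos of rexp.

Inductive cmd : Type :=
| Skip
| Store of nat & iexp & iexp & rexp
| Seq of cmd & cmd
| IfLe of rexp & rexp & cmd & cmd
| For of nat & iexp & cmd.

Definition ienv := nat -> nat.

Definition iupd (e : ienv) (v k : nat) : ienv :=
  fun u => if u == v then k else e u.

Fixpoint ieval (e : ienv) (x : iexp) : nat :=
  match x with
  | IVar v => e v
  | INum n => n
  | IAdd x y => (ieval e x + ieval e y)%N
  | IMul x y => (ieval e x * ieval e y)%N
  end.

Section Semantics.
Variable R : realType.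

Definition store := nat -> nat -> nat -> R.

Definition supd (s : store) (a i j : nat) (x : R) : store :=
  fun a' i' j' => if [&& a' == a, i' == i & j' == j] then x else s a' i' j'.

(* [w] is the random tape.  The library operations are total: x / 0 = 0,
   Num.sqrt x = 0 for x < 0 and ln x = 0 for x <= 0. *)
Fixpoint reval (w : nat -> bool) (e : ienv) (s : store) (x : rexp) : R :=
  match x with
  | RLoad a i j => s a (ieval e i) (ieval e j)
  | RNat i => (ieval e i)%:R
  | RBit i => (w (ieval e i))%:R
  | RPi => pi
  | RAdd x y => reval w e s x + reval w e s y
  | RSub x y => reval w e s x - reval w e s y
  | RMul x y => reval w e s x * reval w e s y
  | RDiv x y => reval w e s x / reval w e s y
  | RSqrt x => Num.sqrt (reval w e s x)
  | RLn x => ln (reval w e s x)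
  | RCos x => cos (reval w e s x)
  end.

Fixpoint run (w : nat -> bool) (e : ienv) (c : cmd) (s : store) : store :=
  match c with
  | Skip => s
  | Store a i j x => supd s a (ieval e i) (ieval e j) (reval w e s x)
  | Seq c1 c2 => run w e c2 (run w e c1 s)
  | IfLe x y c1 c2 =>
      if reval w e s x <= reval w e s y then run w e c1 s else run w e c2 s
  | For v n c =>
      foldl (fun s' k => run w (iupd e v k) c s') s (iota 0 (ieval e n))
  end.

End Semantics.

Fixpoint isize (x : iexp) : nat :=
  match x with
  | IVar _ | INum _ => 1
  | IAdd x y | IMul x y => (isize x + isize y).+1
  end.

Fixpoint rsize (x : rexp) : nat :=
  match x with
  | RLoad _ i j => (isize i + isize j).+1
  | RNat i | RBit i => (isize i).+1
  | RPi => 1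
  | RAdd x y | RSub x y | RMul x y | RDiv x y => (rsize x + rsize y).+1
  | RSqrt x | RLn x | RCos x => (rsize x).+1
  end.

(* Worst-case number of elementary operations. *)
Fixpoint steps (e : ienv) (c : cmd) : nat :=
  match c with
  | Skip => 1
  | Store _ i j x => (isize i + isize j + rsize x).+1
  | Seq c1 c2 => (steps e c1 + steps e c2)%N
  | IfLe x y c1 c2 => (rsize x + rsize y + maxn (steps e c1) (steps e c2)).+1
  | For v n c =>
      (isize n + \sum_(k < ieval e n) (steps (iupd e v k) c).+1).+1%N
  end.

Record algorithm : Type := Algorithm { nbits : iexp; body : cmd }.

(* Input sizes: N is index variable 0, D is index variable 1. *)
Definition sizes (N D : nat) : ienv :=
  fun v => if v == 0%N then N else if v == 1%N then D else 0%N.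

Definition polynomial_time (A : algorithm) : Prop :=
  exists c k : nat, forall N D : nat,
    (ieval (sizes N D) (nbits A) + steps (sizes N D) (body A)
       <= c * (N + D).+1 ^ k)%N.

Section Runs.
Variables (R : realType) (N D : nat) (A : algorithm).
Variables (Sigma : 'M[R]_N) (rho : R).

Let L : nat := ieval (sizes N D) (nbits A).

(* Sigma is input in array 0 and rho in entry (0, 0) of array 1. *)
Definition input_store : store R := fun a i j =>
  match a with
  | 0 => if insub i is Some p then if insub j is Some q then Sigma p q else 0
         else 0
  | 1 => if (i == 0%N) && (j == 0%N) then rho else 0
  | _ => 0
  end.

Definition final_store (w : L.-tuple bool) : store R :=
  run (nth false w) (sizes N D) (body A) input_store.

(* lambda_j is output in entry (j, 0) of array 2, and g_j in column j of
   array 3. *)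
Definition out_lambda (w : L.-tuple bool) (j : 'I_N) : R :=
  final_store w 2 j 0.

Definition out_g (w : L.-tuple bool) (j : 'I_N) : 'cV[R]_N :=
  \col_(p < N) final_store w 3 p j.

(* Probability, over a uniformly random tape of L bits, that the output
   satisfies P. *)
Definition success_probability
    (P : ('I_N -> R) -> ('I_N -> 'cV[R]_N) -> Prop) : R :=
  #|[pred w : L.-tuple bool | `[< P (out_lambda w) (out_g w) >]]|%:R / 2 ^+ L.

End Runs.

(* Main.v *)
(* Write Sigma = sum_k f_k f_k^T by Cholesky factorization, let O be the DCT-IV
   matrix, which is orthogonal with entries at most sqrt(2/N) in absolute value,
   and let eps be a vector of independent random signs.  The columns
   h_j = sum_k eps_k O_kj f_k satisfy sum_j h_j h_j^T = Sigma for every eps,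
   while S_i[h_j] is a Rademacher sum of symmetric matrices with variance
   sum_k O_kj^2 S_i[f_k]^2 <= (2/N) S_i[Sigma] <= (2/N) rho r_i I.  The tail
   bound P(|X| > t sigma) <= 2 d exp(-t^2/2) for such sums, with
   t^2 = 2 ln(4DN), and a union bound over i and j show that with probability
   at least 1/2 all the vectors sqrt(N / (kappa rho)) h_j lie in the
   spectratope.

   The tail bound comes from the moment recursion
   E tr X^(2p+2) <= (2p+1) E tr(V X^(2p)), V the variance: flipping one sign
   turns E eps_k tr(A_k X^(2p+1)) into a telescoping sum of the terms
   tr(A_k X^q A_k Y^(2p-q)), which are controlled by their convexity in q. *)

Require Import Defs.
From mathcomp Require Import all_boot all_order all_algebra.
From mathcomp Require Import sesquilinear ring lra zify.
From mathcomp Require Import all_classical all_reals all_analysis.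

Set Implicit Arguments.
Unset Strict Implicit.
Unset Printing Implicit Defensive.

Import Order.TTheory GRing.Theory Num.Theory.
Import numFieldNormedType.Exports.

Local Open Scope classical_set_scope.
Local Open Scope ring_scope.

(** * Quadratic forms and semidefinite matrices *)

Section PositiveSemidefinite.
Variable R : realType.

Lemma symmetricmxP (n : nat) (A : 'M[R]_n) :
  reflect (A^T = A) (A \is symmetricmx).
Proof.
rewrite qualifE /= /form_of_matrix /= ?expr0 scale1r map_mx_id //.
by rewrite eq_sym; apply: eqP.
Qed.

Definition bform (n : nat) (A : 'M[R]_n) (x y : 'cV[R]_n) : R :=
  (x^T *m A *m y) 0 0.

Lemma bformDl n (A : 'M[R]_n) x x' y :
  bform A (x + x') y = bform A x y + bform A x' y.
Proof. by rewrite /bform linearD /= !mulmxDl mxE. Qed.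

Lemma bformDr n (A : 'M[R]_n) x y y' :
  bform A x (y + y') = bform A x y + bform A x y'.
Proof. by rewrite /bform mulmxDr mxE. Qed.

Lemma bformZl n (A : 'M[R]_n) a x y : bform A (a *: x) y = a * bform A x y.
Proof. by rewrite /bform linearZ /= -!scalemxAl mxE. Qed.

Lemma bformZr n (A : 'M[R]_n) a x y : bform A x (a *: y) = a * bform A x y.
Proof. by rewrite /bform -scalemxAr mxE. Qed.

Lemma bform_addm n (A B : 'M[R]_n) x y :
  bform (A + B) x y = bform A x y + bform B x y.
Proof. by rewrite /bform mulmxDr mulmxDl mxE. Qed.

Lemma bform_oppm n (A : 'M[R]_n) x y : bform (- A) x y = - bform A x y.
Proof. by rewrite /bform mulmxN mulNmx mxE. Qed.

Lemma bform_scalem n a (A : 'M[R]_n) x y : bform (a *: A) x y = a * bform A x y.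
Proof. by rewrite /bform -scalemxAr -scalemxAl mxE. Qed.

Lemma bform_tr n (A : 'M[R]_n) x y : bform A^T x y = bform A y x.
Proof.
rewrite /bform; transitivity ((y^T *m A *m x)^T 0 0); last by rewrite mxE.
by rewrite !trmx_mul trmxK mulmxA.
Qed.

Lemma bform_conj n m (B : 'M[R]_(n, m)) (A : 'M[R]_n) x y :
  bform (B^T *m A *m B) x y = bform A (B *m x) (B *m y).
Proof. by rewrite /bform trmx_mul !mulmxA. Qed.

Lemma bform_scalar n a (x y : 'cV[R]_n) : bform a%:M x y = a * bform 1%:M x y.
Proof. by rewrite -bform_scalem scalemx1. Qed.

Lemma bform1E n (x y : 'cV[R]_n) : bform 1%:M x y = \sum_i x i 0 * y i 0.
Proof.
rewrite /bform mulmx1 mxE; apply: eq_bigr => i _; by rewrite mxE.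
Qed.

Lemma bform1_ge0 n (x : 'cV[R]_n) : 0 <= bform 1%:M x x.
Proof. by rewrite bform1E sumr_ge0 // => i _; rewrite -expr2 sqr_ge0. Qed.

Lemma bform1_eq0 n (x : 'cV[R]_n) : bform 1%:M x x <= 0 -> x = 0.
Proof.
rewrite bform1E => x0; apply/matrixP => i j; rewrite ord1 mxE.
apply/eqP; rewrite -sqrf_eq0 eq_le sqr_ge0 andbT.
apply: le_trans x0; rewrite (bigD1 i) //= -expr2 lerDl sumr_ge0 // => k _.
by rewrite -expr2 sqr_ge0.
Qed.

Lemma bform_delta n (A : 'M[R]_n) i j :
  bform A (delta_mx i 0) (delta_mx j 0) = A i j.
Proof. by rewrite /bform trmx_delta -rowE -colE !mxE. Qed.

Lemma psdP n (A : 'M[R]_n) : A^T = A -> (forall x, 0 <= bform A x x) -> psd A.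
Proof. by move=> sA qA; split => //; apply/symmetricmxP. Qed.

Lemma psd_sym n (A : 'M[R]_n) : psd A -> A^T = A.
Proof. by case=> /symmetricmxP. Qed.

Lemma psd_bform n (A : 'M[R]_n) x : psd A -> 0 <= bform A x x.
Proof. by case=> _ /(_ x). Qed.

Lemma psd0 n : psd (0 : 'M[R]_n).
Proof. by apply: psdP => [|x]; rewrite ?trmx0 // /bform mulmx0 mul0mx mxE. Qed.

Lemma psdD n (A B : 'M[R]_n) : psd A -> psd B -> psd (A + B).
Proof.
move=> pA pB; apply: psdP => [|x].
  by rewrite linearD /= !psd_sym.
by rewrite bform_addm addr_ge0 ?psd_bform.
Qed.

Lemma psdZ n a (A : 'M[R]_n) : 0 <= a -> psd A -> psd (a *: A).
Proof.
move=> a0 pA; apply: psdP => [|x]; first by rewrite linearZ /= psd_sym.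
by rewrite bform_scalem mulr_ge0 // psd_bform.
Qed.

Lemma psd_sum n (J : Type) (r : seq J) (P : pred J) (F : J -> 'M[R]_n) :
  (forall j, P j -> psd (F j)) -> psd (\sum_(j <- r | P j) F j).
Proof.
move=> pF; elim/big_rec: _ => [|j A Pj pA]; first exact: psd0.
by apply: psdD => //; exact: pF.
Qed.

Lemma psd_scalar n a : 0 <= a -> psd (a%:M : 'M[R]_n).
Proof.
move=> a0; apply: psdP => [|x]; first by rewrite tr_scalar_mx.
by rewrite bform_scalar mulr_ge0 // bform1_ge0.
Qed.

Lemma psd_conj n m (B : 'M[R]_(n, m)) (A : 'M[R]_n) :
  psd A -> psd (B^T *m A *m B).
Proof.
move=> pA; apply: psdP => [|x]; last by rewrite bform_conj psd_bform.
by rewrite !trmx_mul trmxK psd_sym // mulmxA.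
Qed.

Lemma psd_gram n m (B : 'M[R]_(n, m)) : psd (B^T *m B).
Proof.
by rewrite -[X in X *m B]mulmx1; apply/psd_conj/psd_scalar/ler01.
Qed.

Lemma psd_outer n (g : 'cV[R]_n) : psd (g *m g^T).
Proof. by rewrite -{1}[g]trmxK; exact: psd_gram. Qed.

Lemma psd_trace_ge0 n (A : 'M[R]_n) : psd A -> 0 <= \tr A.
Proof.
move=> pA; apply: sumr_ge0 => i _.
by rewrite -bform_delta psd_bform.
Qed.

(** The quadratic polynomial t -> form of [A] at [x + t *: y] is nonnegative for all t. *)
Lemma psd_cauchy_schwarz n (A : 'M[R]_n) x y : psd A ->
  bform A x y ^+ 2 <= bform A x x * bform A y y.
Proof.
move=> pA; set a := bform A x x; set b := bform A x y; set c := bform A y y.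
have b' : bform A y x = b by rewrite -bform_tr psd_sym.
have quad t : 0 <= a + t * b *+ 2 + t ^+ 2 * c.
  have := psd_bform (x + t *: y) pA.
  rewrite bformDl !bformDr !bformZl !bformZr b' -/a -/b -/c.
  suff -> : a + t * b + (t * b + t * (t * c)) =
            a + t * b *+ 2 + t ^+ 2 * c by [].
  ring.
have c0 : 0 <= c by exact: psd_bform.
have [c1|c1|c1] := ltgtP c 0; first by rewrite leNgt c1 in c0.
  (* The minimizer of the quadratic. *)
  have := quad (- b / c).
  have -> : a + (- b / c) * b *+ 2 + (- b / c) ^+ 2 * c = (a * c - b ^+ 2) / c.
    by field; rewrite gt_eqF.
  by rewrite pmulr_lge0 ?invr_gt0 // subr_ge0.
rewrite c1 mulr0; have [->|b0] := eqVneq b 0; first by rewrite expr0n.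
(* With c = 0 the polynomial is a + 2bt, and this t gives the negative value -a - 2. *)
have := quad (- (a + 1) / b); rewrite c1 mulr0 addr0.
have -> : a + - (a + 1) / b * b *+ 2 = - a - 2 by field.
have : 0 <= a by exact: psd_bform.
by move=> ? ?; exfalso; lra.
Qed.

Lemma psd_diag0 n (A : 'M[R]_n) i k : psd A -> A k k = 0 -> A i k = 0.
Proof.
move=> pA k0; apply/eqP; rewrite -sqrf_eq0 eq_le sqr_ge0 andbT.
have := psd_cauchy_schwarz (delta_mx i 0) (delta_mx k 0) pA.
by rewrite !bform_delta k0 mulr0.
Qed.

(** [B^T *m B] is the sum of r^T r over the rows r of [B], and (r x)^2 <= |r|^2 |x|^2 for each row.
    This lets the trace stand in for the spectral norm. *)
Lemma bform_gram_le_trace n m (B : 'M[R]_(m, n)) x :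
  bform (B^T *m B) x x <= \tr (B^T *m B) * bform 1%:M x x.
Proof.
have -> : B^T *m B = \sum_i ((row i B)^T *m row i B).
  apply/matrixP => p q; rewrite mxE summxE; apply: eq_bigr => i _.
  by rewrite !mxE big_ord1 !mxE.
rewrite raddf_sum mulr_suml.
rewrite /bform mulmx_sumr mulmx_suml summxE; apply: ler_sum => i _.
rewrite -!/(bform _ _ _) -[X in X *m row i B]mulmx1 bform_conj bform1E big_ord1.
set r := row i B.
have -> : (r *m x) 0 0 = bform 1%:M r^T x by rewrite /bform mulmx1 trmxK.
rewrite mulmx1 /= mxtrace_mulC [\tr (_ *m _)]big_ord1.
have -> : (r *m r^T) 0 0 = bform 1%:M r^T r^T by rewrite /bform mulmx1 trmxK.
rewrite -expr2; apply: psd_cauchy_schwarz; exact: psd_scalar.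
Qed.

End PositiveSemidefinite.

(** * Matrix Khintchine inequality *)

Section MatrixKhintchine.
Variable R : realType.

Lemma trmxM n (A B : 'M[R]_n) : (A * B)^T = B^T * A^T.
Proof. exact: trmx_mul. Qed.

Lemma trmxX n (A : 'M[R]_n) k : (A ^+ k)^T = A^T ^+ k.
Proof.
elim: k => [|k IHk]; first by rewrite !expr0 trmx1.
by rewrite exprS trmxM IHk exprSr.
Qed.

Lemma mxtraceC n (A B : 'M[R]_n) : \tr (A * B) = \tr (B * A).
Proof. exact: mxtrace_mulC. Qed.

Lemma scalemxMl n a (A B : 'M[R]_n) : a *: A * B = a *: (A * B).
Proof. by rewrite -mulmxE scalemxAl. Qed.

Lemma scalemxMr n a (A B : 'M[R]_n) : A * (a *: B) = a *: (A * B).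
Proof. by rewrite -mulmxE scalemxAr. Qed.

Lemma trace_gram_ge0 n (B : 'M[R]_n) : 0 <= \tr (B^T * B).
Proof. exact/psd_trace_ge0/psd_gram. Qed.

(* The right-hand side minus the left-hand side is the squared Frobenius norm
   of X^a (X^c A - A Y^c) Y^b. *)
Lemma trace_midpoint n (X Y A : 'M[R]_n) a b c :
  X^T = X -> Y^T = Y -> A^T = A ->
  2 * \tr (A * X ^+ (a.*2 + c) * A * Y ^+ (b.*2 + c)) <=
  \tr (A * X ^+ a.*2 * A * Y ^+ (b.*2 + c.*2)) +
  \tr (A * X ^+ (a.*2 + c.*2) * A * Y ^+ b.*2).
Proof.
move=> sX sY sA; rewrite -subr_ge0.
set B := X ^+ a * (X ^+ c * A - A * Y ^+ c) * Y ^+ b.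
suff <- : \tr (B^T * B) = \tr (A * X ^+ a.*2 * A * Y ^+ (b.*2 + c.*2)) +
  \tr (A * X ^+ (a.*2 + c.*2) * A * Y ^+ b.*2) -
  2 * \tr (A * X ^+ (a.*2 + c) * A * Y ^+ (b.*2 + c)).
  exact: trace_gram_ge0.
have -> : B^T = Y ^+ b * (A * X ^+ c - Y ^+ c * A) * X ^+ a.
  by rewrite /B !trmxM linearB /= !trmxM !trmxX sX sY sA mulrA.
have -> : \tr (Y ^+ b * (A * X ^+ c - Y ^+ c * A) * X ^+ a * B) =
    \tr ((A * X ^+ c - Y ^+ c * A) * X ^+ a.*2 * (X ^+ c * A - A * Y ^+ c)
         * Y ^+ b.*2).
  rewrite -!mulrA mxtraceC /B -!addnn !exprD !mulrA; congr (\tr _).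
rewrite !(mulrBl, mulrBr) !raddfB /=.
have -> : \tr (Y ^+ c * A * X ^+ a.*2 * (X ^+ c * A) * Y ^+ b.*2) =
          \tr (A * X ^+ (a.*2 + c) * A * Y ^+ (b.*2 + c)).
  by rewrite -!mulrA mxtraceC !exprD !mulrA.
have -> : \tr (Y ^+ c * A * X ^+ a.*2 * (A * Y ^+ c) * Y ^+ b.*2) =
          \tr (A * X ^+ a.*2 * A * Y ^+ (b.*2 + c.*2)).
  rewrite -!mulrA mxtraceC -exprD !mulrA -(mulrA _ (Y ^+ _)) -exprD.
  by rewrite addnAC addnn addnC.
have -> : A * X ^+ c * X ^+ a.*2 * (X ^+ c * A) * Y ^+ b.*2 =
          A * X ^+ (a.*2 + c.*2) * A * Y ^+ b.*2.
  by rewrite !mulrA -(mulrA A) -exprD -(mulrA A) -exprD addnAC addnn addnC.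
have -> : A * X ^+ c * X ^+ a.*2 * (A * Y ^+ c) * Y ^+ b.*2 =
          A * X ^+ (a.*2 + c) * A * Y ^+ (b.*2 + c).
  by rewrite !mulrA -(mulrA A) -exprD -(mulrA _ (Y ^+ c)) -exprD !(addnC c).
ring.
Qed.

(** Trapezoid inequality under weak convexity: [T] is convex along even indices, and each odd value
    is at most the mean of its neighbours. These are midpoints that [trace_midpoint] supplies, where
    the outer exponents must be even. *)
Lemma sum_le_of_midpoints (K : nat) (T : nat -> R) :
  (forall a, (a < K)%N -> 2 * T a.*2.+1 <= T a.*2 + T a.+1.*2) ->
  (forall a, (a.+1 < K)%N -> 2 * T a.+1.*2 <= T a.*2 + T a.+2.*2) ->
  2 * \sum_(q < K.*2.+1) T q <= K.*2.+1%:R * (T 0 + T K.*2).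
Proof.
move=> odd_mid even_mid.
(* Convexity along even indices puts the value at 2k below the chord from 0 to 2k + 2. *)
have chord k : (k < K)%N -> k.+1%:R * T k.*2 <= T 0 + k%:R * T k.+1.*2.
  elim: k => [|k IHk] kK; first by rewrite mul1r mul0r addr0.
  have := IHk (ltnW kK); have := even_mid _ kK.
  rewrite -[k.+2]addn1 -[k.+1]addn1 !natrD.
  have := ler0n R k; set x := k%:R; nra.
suff main k : (k <= K)%N ->
    2 * \sum_(q < k.*2.+1) T q <= k.*2.+1%:R * (T 0 + T k.*2) by exact: main.
elim: k => [|k IHk] kK; first by rewrite big_ord1 mul1r; lra.
rewrite doubleS !big_ord_recr /= -doubleS.
have := IHk (ltnW kK); have := chord _ kK; have := odd_mid _ kK.
rewrite big_ord_recr /= doubleS.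
rewrite -[k.*2.+3]addn3 -[k.*2.+1]addn1 -[k.+1]addn1 -muln2 !natrD natrM.
set s := \sum_(_ < _) _; set x := k%:R; set T0 := T 0; lra.
Qed.

(** The summand is midpoint convex in q, and its values at q = 2k and q = 0 are the two traces on
    the right. *)
Lemma trace_heinz n (X Y A : 'M[R]_n) k :
  X^T = X -> Y^T = Y -> A^T = A ->
  2 * \sum_(q < k.*2.+1) \tr (A * X ^+ q * A * Y ^+ (k.*2 - q)) <=
  k.*2.+1%:R * (\tr (A * A * X ^+ k.*2) + \tr (A * A * Y ^+ k.*2)).
Proof.
move=> sX sY sA.
pose T q := \tr (A * X ^+ q * A * Y ^+ (k.*2 - q)).
have -> : \tr (A * A * X ^+ k.*2) = T k.*2.
  by rewrite /T subnn expr0 mulr1 [RHS]mxtraceC mulrA.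
have -> : \tr (A * A * Y ^+ k.*2) = T 0 by rewrite /T subn0 expr0 mulr1.
rewrite addrC; apply: (@sum_le_of_midpoints k T) => a ak.
(* Increment c = 1 gives the odd midpoints; c = 2, in the next case, gives convexity along even
   indices. *)
- have := trace_midpoint a (k - a.+1) 1 sX sY sA.
  rewrite /T.
  have -> : (k.*2 - a.*2.+1 = (k - a.+1).*2 + 1)%N by lia.
  have -> : (k.*2 - a.*2 = (k - a.+1).*2 + 1.*2)%N by lia.
  have -> : (k.*2 - a.+1.*2 = (k - a.+1).*2)%N by lia.
  have -> : (a.*2 + 1 = a.*2.+1)%N by lia.
  by have -> : (a.*2 + 1.*2 = a.+1.*2)%N by lia.
- have := trace_midpoint a (k - a.+2) 2 sX sY sA.
  rewrite /T.
  have -> : (k.*2 - a.+1.*2 = (k - a.+2).*2 + 2)%N by lia.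
  have -> : (k.*2 - a.*2 = (k - a.+2).*2 + 2.*2)%N by lia.
  have -> : (k.*2 - a.+2.*2 = (k - a.+2).*2)%N by lia.
  have -> : (a.*2 + 2 = a.+1.*2)%N by lia.
  by have -> : (a.*2 + 2.*2 = a.+2.*2)%N by lia.
Qed.

Lemma exprB_telescope n (X Y : 'M[R]_n) m :
  X ^+ m - Y ^+ m = \sum_(q < m) X ^+ q * (X - Y) * Y ^+ (m.-1 - q).
Proof.
elim: m => [|m IHm]; first by rewrite big_ord0 !expr0 subrr.
have -> : X ^+ m.+1 - Y ^+ m.+1 = (X - Y) * Y ^+ m + X * (X ^+ m - Y ^+ m).
  by rewrite !exprS mulrBl mulrBr [RHS]addrC addrA subrK.
rewrite IHm mulr_sumr big_ord_recl /= expr0 mul1r subn0; congr (_ + _).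
apply: eq_bigr => q _; rewrite /bump /= add1n exprS !mulrA.
by congr (_ * Y ^+ _); lia.
Qed.

(** Arithmetic form of the sign of a bit, matching the expression that [mix_term] evaluates. *)
Definition sign (b : bool) : R := 2 * b%:R - 1.

Lemma sign_sqr b : sign b * sign b = 1.
Proof. by rewrite /sign; case: b => /=; ring. Qed.

Lemma sign_negb b : sign (~~ b) = - sign b.
Proof. by rewrite /sign; case: b => /=; ring. Qed.

(** * Rademacher sums of symmetric matrices and their moment recursion *)

Section Rademacher.
Variables (N n : nat) (A : 'I_N -> 'M[R]_n).
Implicit Type w : N.-tuple bool.

Definition rademacher w : 'M[R]_n := \sum_k sign (tnth w k) *: A k.

Definition flip (k : 'I_N) w : N.-tuple bool :=
  [tuple tnth w i (+) (i == k) | i < N].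

Lemma flipK k : involutive (flip k).
Proof.
by move=> w; apply: eq_from_tnth => i; rewrite !tnth_mktuple addbK.
Qed.

Lemma rademacher_flip k w :
  rademacher w - rademacher (flip k w) = (2 * sign (tnth w k)) *: A k.
Proof.
rewrite /rademacher -sumrB (bigD1 k) //= big1 ?addr0 => [|i ik].
  rewrite tnth_mktuple eqxx addbT sign_negb scaleNr opprK -scalerDl.
  by congr (_ *: _); ring.
by rewrite tnth_mktuple (negPf ik) addbF subrr.
Qed.

Hypothesis symA : forall k, (A k)^T = A k.

Lemma rademacher_sym w : (rademacher w)^T = rademacher w.
Proof.
by rewrite linear_sum; apply: eq_bigr => k _; rewrite linearZ /= symA.
Qed.

(* Pairing each tape with its flip in position k turns the sign into the
   difference of two (2p+1)-st powers. *)
Lemma sum_sign_trace_le k p :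
  \sum_w sign (tnth w k) * \tr (A k * rademacher w ^+ p.*2.+1) <=
  p.*2.+1%:R * \sum_w \tr (A k * A k * rademacher w ^+ p.*2).
Proof.
set F := fun w => sign (tnth w k) * \tr (A k * rademacher w ^+ p.*2.+1).
set G := fun w => \tr (A k * A k * rademacher w ^+ p.*2).
have reindexF : \sum_w F w = \sum_w F (flip k w).
  by rewrite (reindex_inj (inv_inj (flipK k))).
have reindexG : \sum_w G w = \sum_w G (flip k w).
  by rewrite (reindex_inj (inv_inj (flipK k))).
(* Doubling both sides leaves room for each sum together with its flipped copy. *)
have two (x y : R) : 2 * x <= 2 * y -> x <= y by lra.
apply: two; rewrite -[X in X <= _]/(2 * \sum_w F w).
rewrite -[X in _ <= _ * (_ * X)]/(\sum_w G w).
rewrite [X in _ <= X]mulrCA !mulrDl !mul1r {2}reindexF {2}reindexG.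
rewrite -!big_split /=.
rewrite mulr_sumr; apply: ler_sum => w _.
set X := rademacher w; set Y := rademacher (flip k w).
(* The flipped tape has the opposite sign, leaving sign times X^(2p+1) - Y^(2p+1). Telescoping
   produces X - Y, twice the sign times [A k], and the two signs cancel. *)
have -> : F w + F (flip k w) =
    2 * \sum_(q < p.*2.+1) \tr (A k * X ^+ q * A k * Y ^+ (p.*2 - q)).
  rewrite /F -/X -/Y tnth_mktuple eqxx addbT sign_negb mulNr -mulrBr.
  rewrite -raddfB -mulrBr exprB_telescope rademacher_flip /=.
  rewrite [A k * _]mulr_sumr raddf_sum !mulr_sumr; apply: eq_bigr => q _ /=.
  rewrite scalemxMr scalemxMl scalemxMr mxtraceZ mulrCA !mulrA.
  by rewrite -(mulrA 2) sign_sqr mulr1.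
by apply: trace_heinz; rewrite ?rademacher_sym.
Qed.

(** One factor of the power is expanded as a signed sum, and [sum_sign_trace_le] is applied to each
    k. *)
Lemma sum_trace_rademacher_le p :
  \sum_w \tr (rademacher w ^+ p.*2.+2) <=
  p.*2.+1%:R * \sum_w \tr ((\sum_k A k * A k) * rademacher w ^+ p.*2).
Proof.
have -> : \sum_w \tr (rademacher w ^+ p.*2.+2) =
   \sum_k \sum_w sign (tnth w k) * \tr (A k * rademacher w ^+ p.*2.+1).
  rewrite [RHS]exchange_big; apply: eq_bigr => w _ /=.
  rewrite exprS {1}/rademacher mulr_suml raddf_sum; apply: eq_bigr => k _ /=.
  by rewrite scalemxMl mxtraceZ.
have -> : \sum_w \tr ((\sum_k A k * A k) * rademacher w ^+ p.*2) =
   \sum_k \sum_w \tr (A k * A k * rademacher w ^+ p.*2).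
  rewrite [RHS]exchange_big; apply: eq_bigr => w _ /=.
  by rewrite mulr_suml raddf_sum.
by rewrite mulr_sumr; apply: ler_sum => k _; exact: sum_sign_trace_le.
Qed.

End Rademacher.
End MatrixKhintchine.

(** * Tail bound for Rademacher sums *)

Section TailBound.
Variable R : realType.

(** The difference is symmetric anyway, so only its quadratic form can fail. *)
Lemma psd_scalarB_gram n (u : R) (X : 'M[R]_n) : X^T = X ->
  ~ psd (u%:M - X * X) ->
  exists x : 'cV[R]_n, u * bform 1%:M x x < bform (X * X) x x.
Proof.
move=> sX; apply: contra_notP => /forallNP nX; apply: psdP => [|x].
  by rewrite linearB /= tr_scalar_mx trmxM sX.
rewrite bform_addm bform_oppm bform_scalar subr_ge0 leNgt.
by apply/negP/nX.
Qed.

(* By Cauchy-Schwarz the moments x^T X^(2p) x are log-convex in p. *)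
Lemma trace_pow_ge n (u : R) (X : 'M[R]_n) p : X^T = X -> 0 <= u ->
  ~ psd (u%:M - X * X) -> u ^+ p <= \tr (X ^+ p.*2).
Proof.
move=> sX u0 /(psd_scalarB_gram sX) [x xu].
pose m p := bform 1%:M (X ^+ p *m x) (X ^+ p *m x).
have m0E : m 0%N = bform 1%:M x x by rewrite /m expr0 mul1mx.
have gramE q : bform ((X ^+ q)^T *m X ^+ q) x x = m q.
  by rewrite -[X in X *m _]mulmx1 bform_conj.
have m_ge0 q : 0 <= m q by exact: bform1_ge0.
have m1E : bform (X * X) x x = m 1%N by rewrite -gramE expr1 sX.
have CS q : m q.+1 ^+ 2 <= m q * m q.+2.
  have <- : bform 1%:M (X ^+ q *m x) (X ^+ q.+2 *m x) = m q.+1.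
    rewrite /m 2!exprS -!mulmxE -!mulmxA /bform !mulmx1.
    by rewrite [in RHS]trmx_mul sX -!mulmxA.
  by apply: psd_cauchy_schwarz; exact/psd_scalar/ler01.
have m0_gt0 : 0 < m 0%N.
  rewrite lt_neqAle m_ge0 andbT eq_sym; apply/eqP => m00.
  move: xu; rewrite m1E -m0E m00 mulr0.
  have x0 : x = 0 by apply: bform1_eq0; rewrite -m0E m00.
  by rewrite /m x0 mulmx0 /bform mulmx0 mxE ltxx.
(* By [CS] the ratios m(q+1) / m(q) are nondecreasing, and the first one exceeds u by the choice of
   x. Positivity is carried along to allow cancellation. *)
have ratio q : 0 < m q /\ u * m q < m q.+1.
  elim: q => [|q [mq mq1]]; first by rewrite m0_gt0 -m1E m0E.
  have mq1_gt0 : 0 < m q.+1 by apply: le_lt_trans mq1; rewrite mulr_ge0.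
  split => //; rewrite -(ltr_pM2l mq); apply: lt_le_trans (CS q).
  by rewrite expr2 mulrA (mulrC (m q)) ltr_pM2r.
have pow_le : u ^+ p * m 0%N <= m p.
  elim: p => [|q IHq]; first by rewrite expr0 mul1r.
  apply: le_trans (ltW (ratio q).2).
  by rewrite exprS -mulrA ler_wpM2l.
rewrite -(ler_pM2r m0_gt0); apply: (le_trans pow_le).
rewrite -gramE m0E -addnn exprD -{3}sX -trmxX.
exact: bform_gram_le_trace.
Qed.

Lemma trace_sqr_le0 n (X : 'M[R]_n) :
  X^T = X -> \tr (X * X) <= 0 -> psd (0%:M - X * X).
Proof.
move=> sX tX; apply: contrapT => /(psd_scalarB_gram sX) [x].
rewrite mul0r ltNge -{1}sX (le_trans (bform_gram_le_trace _ _)) //.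
by rewrite sX mulmxE mulr_le0_ge0 // bform1_ge0.
Qed.

(** By cyclicity the difference is the trace of the congruence X^p (v - V) X^p. *)
Lemma trace_mulX_le n (v : R) (V X : 'M[R]_n) p : X^T = X ->
  psd (v%:M - V) -> \tr (V * X ^+ p.*2) <= v * \tr (X ^+ p.*2).
Proof.
move=> sX pV; rewrite -subr_ge0 -mxtraceZ -mul_scalar_mx mulmxE.
rewrite -raddfB -mulrBl /= -addnn exprD mulrA mxtraceC mulrA.
by rewrite -{1}sX -trmxX; apply/psd_trace_ge0/psd_conj.
Qed.

Lemma partial_sum_le_expR (x : R) n : 0 <= x ->
  \sum_(p < n) x ^+ p / p`!%:R <= expR x.
Proof.
move=> x0; rewrite -(big_mkord xpredT (fun p => x ^+ p / p`!%:R)).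
have := @nondecreasing_cvgn_le R (series (exp_coeff x)) _ _ n.
apply; last exact: is_cvg_series_exp_coeff.
apply/nondecreasing_seqP => k; rewrite -subr_ge0 /series /= big_nat_recr //=.
by rewrite addrAC subrr add0r /exp_coeff /= divr_ge0 ?exprn_ge0.
Qed.

(** The even sums converge to cosh y, and exp y <= 2 cosh y. *)
Lemma expR_le_of_even_sums (c y K : R) : 0 <= c -> 0 <= y ->
  (forall n, c * (\sum_(p < n) y ^+ p.*2 / p.*2`!%:R) <= K) ->
  c * expR y <= 2 * K.
Proof.
move=> c0 y0 cK.
pose S x n := series (exp_coeff (x : R)) n.
have SE n : S y n.*2 + S (- y) n.*2 = 2 * \sum_(p < n) y ^+ p.*2 / p.*2`!%:R.
  elim: n => [|n IHn]; first by rewrite /S /series /= !big_geq // big_ord0; ring.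
  rewrite big_ord_recr /= mulrDr -IHn /S /series /= !big_nat_recr //=.
  rewrite /exp_coeff /= exprS (exprS (- y)).
  have -> : (- y) ^+ n.*2 = y ^+ n.*2 by rewrite -mul2n !exprM sqrrN.
  ring.
(* The terms y^k + (-y)^k are nonnegative, so extending from n to 2n terms only increases the
   sum. *)
have S_le n : c * (S y n + S (- y) n) <= 2 * K.
  apply: (@le_trans _ _ (c * (S y n.*2 + S (- y) n.*2))).
    apply: ler_wpM2l => //; rewrite /S /series /=.
    rewrite [X in _ <= X + _](@big_cat_nat _ _ _ n) //=; last lia.
    rewrite [X in _ <= _ + X](@big_cat_nat _ _ _ n) //=; last lia.
    rewrite addrACA lerDl -big_split /= sumr_ge0 // => k _.
    rewrite /exp_coeff /= -mulrDl divr_ge0 // -[- y]mulN1r exprMn.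
    rewrite -{1}[y ^+ k]mul1r -mulrDl mulr_ge0 ?exprn_ge0 //.
    by rewrite -signr_odd; case: odd; rewrite ?expr0 ?expr1 ?addrN // addr_ge0.
  by rewrite SE mulrCA ler_pM2l.
have cvgS x : S x @ \oo --> expR x by exact: is_cvg_series_exp_coeff.
have : c * (expR y + expR (- y)) <= 2 * K.
  have cv : (fun n => c * (S y n + S (- y) n)) @ \oo -->
            c * (expR y + expR (- y)).
    by apply: cvgMr; exact: cvgD.
  rewrite -(cvg_lim _ cv) //; apply: limr_le.
    by apply/cvg_ex; eexists; exact: cv.
  by near=> n; exact: S_le.
apply: le_trans; rewrite ler_wpM2l // lerDl; exact: expR_ge0.
Unshelve. all: by end_near.
Qed.

(** * Even moments and the number of tapes with a large deviation *)

Section MomentBound.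
Variables (N n : nat) (A : 'I_N -> 'M[R]_n) (v : R).
Hypothesis symA : forall k, (A k)^T = A k.
Hypothesis v_ge0 : 0 <= v.
Hypothesis varA : psd (v%:M - \sum_k A k * A k).

(** 2^N times the expectation of tr X^(2p); counting tapes avoids normalization. *)
Let moment p : R := \sum_(w : N.-tuple bool) \tr (rademacher A w ^+ p.*2).

Lemma moment_succ p : moment p.+1 <= p.*2.+1%:R * v * moment p.
Proof.
apply: (le_trans (sum_trace_rademacher_le symA p)).
rewrite -mulrA ler_wpM2l // mulr_sumr; apply: ler_sum => w _.
by apply: trace_mulX_le => //; exact: rademacher_sym.
Qed.

(** Division by (2p)! turns the factor 2p+1 of the recursion into 1 / (2(p+1)), which yields the
    coefficients of exp(v/2). The constant [n%:R * 2 ^+ N] is moment 0. *)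
Lemma moment_le p :
  moment p / p.*2`!%:R <= (v / 2) ^+ p / p`!%:R * (n%:R * 2 ^+ N).
Proof.
elim: p => [|p IHp].
  rewrite /moment; under eq_bigr do rewrite expr0 mxtrace1.
  rewrite sumr_const card_tuple card_bool -[X in X / _]mulr_natr natrX.
  by rewrite fact0 !expr0 !divr1 mul1r.
apply: (@le_trans _ _ (p.*2.+1%:R * v * moment p / p.+1.*2`!%:R)).
  by rewrite ler_wpM2r ?invr_ge0 // moment_succ.
have -> : p.*2.+1%:R * v * moment p / p.+1.*2`!%:R =
    v / 2 / p.+1%:R * (moment p / p.*2`!%:R).
  have e : p.*2.+2%:R = 2 * p.+1%:R :> R by rewrite -doubleS -mul2n natrM.
  rewrite doubleS !factS !natrM e.
  by field; rewrite ?nat1r !pnatr_eq0 -!lt0n fact_gt0.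
have -> : (v / 2) ^+ p.+1 / p.+1`!%:R * (n%:R * 2 ^+ N) =
    v / 2 / p.+1%:R * ((v / 2) ^+ p / p`!%:R * (n%:R * 2 ^+ N)).
  rewrite exprS factS natrM.
  by field; rewrite ?nat1r !pnatr_eq0 -!lt0n fact_gt0.
by apply: ler_wpM2l IHp; rewrite !divr_ge0.
Qed.

(** The event that the squared spectral norm is greater than u, phrased in the Loewner order. *)
Definition exceeds (u : R) (w : N.-tuple bool) : bool :=
  ~~ `[< psd (u%:M - rademacher A w * rademacher A w) >].

(** Markov's inequality: an exceeding tape contributes at least u^p by [trace_pow_ge], any other a
    nonnegative trace. *)
Lemma card_exceeds_le_moment (u : R) p : 0 <= u ->
  #|[pred w | exceeds u w]|%:R * u ^+ p <= moment p.
Proof.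
move=> u0; rewrite mulr_natl -sumr_const.
rewrite /moment [leRHS](bigID (exceeds u)) /=.
apply: ler_wpDr; last first.
  apply: ler_sum => w /asboolPn; apply: trace_pow_ge => //.
  exact: rademacher_sym.
apply: sumr_ge0 => w _; rewrite -addnn exprD.
by rewrite -{1}(rademacher_sym symA w) -trmxX; exact: trace_gram_ge0.
Qed.

(* Markov's inequality for cosh of the spectral norm, at the optimal parameter
   theta with theta^2 = y / v. *)
Lemma card_exceeds_le (y : R) : 0 <= y ->
  #|[pred w | exceeds (y * v) w]|%:R <= 2 * (n%:R * 2 ^+ N) * expR (- (y / 2)).
Proof.
(* For v = 0 the parameter theta is undefined, but the recursion makes every tr X^2 vanish, so no
   tape exceeds. *)
move=> y0; have [v0|v0] := eqVneq v 0.
  rewrite (_ : #|_| = 0%N); first by rewrite !mulr_ge0 ?expR_ge0.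
  apply: eq_card0 => w; rewrite !inE /exceeds v0 mulr0; apply/negbTE.
  rewrite negbK; apply/asboolP/trace_sqr_le0; first exact: rademacher_sym.
  have := moment_succ 0; rewrite v0 mulr0 mul0r; apply: le_trans.
  rewrite /moment (bigD1 w) //= expr2 lerDl sumr_ge0 // => w' _.
  by rewrite expr2 -{1}(rademacher_sym symA w') trace_gram_ge0.
have v_gt0 : 0 < v by rewrite lt_neqAle eq_sym v0.
set c := _%:R.
suff : c * expR y <= 2 * (expR (y / 2) * (n%:R * 2 ^+ N)).
  have E0 := expR_gt0 (y / 2).
  have {1}-> : expR y = expR (y / 2) * expR (y / 2).
    by rewrite -expRD; congr expR; field.
  rewrite expRN ler_pdivlMr // => h.
  by rewrite -(ler_pM2r E0) -mulrA (le_trans h) // mulrCA mulrC mulrA.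
apply: expR_le_of_even_sums => // m.
apply: (@le_trans _ _
  (\sum_(p < m) (y / 2) ^+ p / p`!%:R * (n%:R * 2 ^+ N))); last first.
  rewrite -mulr_suml ler_wpM2r ?mulr_ge0 ?exprn_ge0 //.
  by apply: partial_sum_le_expR; rewrite divr_ge0.
rewrite mulr_sumr; apply: ler_sum => p _.
have yv0 : 0 <= y / v by rewrite divr_ge0.
(* y^(2p) = theta^(2p) (y v)^p, so each coefficient reduces to Markov at threshold y v. *)
have -> : c * (y ^+ p.*2 / p.*2`!%:R) =
    (y / v) ^+ p * (c * (y * v) ^+ p / p.*2`!%:R).
  rewrite -addnn exprD !exprMn exprVn; field.
  by rewrite ?pnatr_eq0 -?lt0n ?fact_gt0 ?expf_neq0.
have -> : (y / 2) ^+ p / p`!%:R * (n%:R * 2 ^+ N) =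
    (y / v) ^+ p * ((v / 2) ^+ p / p`!%:R * (n%:R * 2 ^+ N)).
  rewrite !exprMn !exprVn; field.
  by rewrite ?pnatr_eq0 -?lt0n ?fact_gt0 ?expf_neq0.
apply: ler_wpM2l; first exact: exprn_ge0.
apply: le_trans (moment_le p); apply: ler_wpM2r; first by rewrite invr_ge0.
by apply: card_exceeds_le_moment; rewrite mulr_ge0.
Qed.

End MomentBound.
End TailBound.

(** * The DCT-IV matrix *)

Section CosineTransform.
Variable R : realType.

(* The angle is (pi / N) (j + 1/2) (k + 1/2). *)
Definition dct (N k j : nat) : R :=
  Num.sqrt (2 / N%:R) *
  cos (pi * ((2 * j + 1) * (2 * k + 1))%:R / (4 * N)%:R).

Lemma dct_sqr_le N k j : dct N k j ^+ 2 <= 2 / N%:R.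
Proof.
have p0 : 0 <= 2 / N%:R :> R by rewrite divr_ge0.
by rewrite /dct exprMn sqr_sqrtr // ler_piMr.
Qed.

Lemma sin_natpi (n : nat) : sin (pi * n%:R) = 0 :> R.
Proof.
elim: n => [|n IHn]; first by rewrite mulr0 sin0.
by rewrite -natr1 mulrDr mulr1 sinD IHn sinpi mul0r mulr0 addr0.
Qed.

Lemma sin_pi_frac_neq0 (m M : nat) :
  (0 < m < M)%N -> sin (pi * m%:R / M%:R) != 0 :> R.
Proof.
case/andP=> m0 mM; have M0 := ltn_trans m0 mM.
apply/lt0r_neq0/sin_gt0_pi/andP; split.
  by rewrite divr_gt0 ?mulr_gt0 ?pi_gt0 ?ltr0n.
by rewrite -mulrA gtr_pMr ?pi_gt0 // ltr_pdivrMr ?ltr0n // mul1r ltr_nat.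
Qed.

(** Telescoping: 2 sin b cos((2j+1)b) = sin((2j+2)b) - sin(2jb). *)
Lemma sum_cos_odd (N : nat) (b : R) :
  2 * sin b * \sum_(j < N) cos ((2 * j + 1)%:R * b) = sin ((2 * N)%:R * b).
Proof.
elim: N => [|N IHN]; first by rewrite big_ord0 mulr0 muln0 mul0r sin0.
rewrite big_ord_recr /= mulrDr IHN.
have -> : (2 * N.+1)%:R * b = (2 * N + 1)%:R * b + b by ring.
have -> : (2 * N)%:R * b = (2 * N + 1)%:R * b - b by ring.
rewrite sinB sinD; ring.
Qed.

Lemma sum_cos_odd_eq0 (N : nat) (b : R) :
  sin b != 0 -> sin ((2 * N)%:R * b) = 0 ->
  \sum_(j < N) cos ((2 * j + 1)%:R * b) = 0.
Proof.
move=> b0 sb; apply/eqP; rewrite -(mulrI_eq0 _ (mulfI (_ : 2 * sin b != 0))).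
  by rewrite sum_cos_odd sb.
by rewrite mulf_neq0 // pnatr_eq0.
Qed.

(** Product-to-sum formulas give cosine sums at the difference and the sum of two angles. Multiplied
    by 2N, both become integer multiples of pi, so both sums vanish, except that for k = l the
    difference is 0 and its sum is N. *)
Lemma dct_orthonormal (N k l : nat) : (k < N)%N -> (l < N)%N ->
  \sum_(j < N) dct N k j * dct N l j = (k == l)%:R.
Proof.
move=> kN lN; have N0 : (0 < N)%N by exact: leq_ltn_trans kN.
have N0' : N%:R != 0 :> R by rewrite pnatr_eq0 -lt0n.
pose t (m : nat) : R := pi * m%:R / (4 * N)%:R.
have prodE (j : nat) : dct N k j * dct N l j =
  N%:R^-1 * (cos ((2 * j + 1)%:R * (t (2 * k + 1)%N - t (2 * l + 1)%N)) +
             cos ((2 * j + 1)%:R * (t (2 * k + 1)%N + t (2 * l + 1)%N))).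
  have tE m : pi * ((2 * j + 1) * m)%:R / (4 * N)%:R = (2 * j + 1)%:R * t m.
    rewrite /t natrM; ring.
  rewrite /dct !tE [_ * (t _ - t _)]mulrBr [_ * (t _ + t _)]mulrDr cosB cosD.
  have p0 : 0 <= 2 / N%:R :> R by rewrite divr_ge0.
  rewrite mulrACA -expr2 sqr_sqrtr //; ring.
under eq_bigr do rewrite prodE.
rewrite -mulr_sumr big_split /=.
have -> : t (2 * k + 1)%N + t (2 * l + 1)%N =
          pi * (2 * (k + l + 1))%:R / (4 * N)%:R.
  by rewrite /t; field; rewrite N0'.
rewrite [X in _ + X]sum_cos_odd_eq0; first last.
- have -> : (2 * N)%:R * (pi * (2 * (k + l + 1))%:R / (4 * N)%:R) =
    pi * (k + l + 1)%:R :> R by field; rewrite N0'.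
  exact: sin_natpi.
- by apply: sin_pi_frac_neq0; lia.
rewrite addr0; have [->|kl] := eqVneq k l.
  under eq_bigr do rewrite subrr mulr0 cos0.
  by rewrite sumr_const card_ord mulVf.
rewrite sum_cos_odd_eq0 ?mulr0 //; last first.
  have -> : (2 * N)%:R * (t (2 * k + 1)%N - t (2 * l + 1)%N) =
    pi * k%:R - pi * l%:R by rewrite /t; field; rewrite N0'.
  by rewrite sinB !sin_natpi mul0r mulr0 subrr.
have sub_neq0 p q : (q < p < N)%N ->
    sin (t (2 * p + 1)%N - t (2 * q + 1)%N) != 0.
  case/andP=> qp pN.
  have -> : t (2 * p + 1)%N - t (2 * q + 1)%N =
     pi * (2 * (p - q))%:R / (4 * N)%:R.
    have -> : (2 * (p - q))%:R = 2 * (p%:R - q%:R) :> R.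
      by rewrite natrM natrB // ltnW.
    by rewrite /t; field; rewrite N0'.
  by apply: sin_pi_frac_neq0; lia.
have [lk|lk] := ltnP l k; first by apply: sub_neq0; rewrite lk.
rewrite -opprB sinN oppr_eq0; apply: sub_neq0.
by rewrite lN ltn_neqAle kl lk.
Qed.

End CosineTransform.

(** * The spectratopic cone *)

Section Cone.
Variable R : realType.
Variables (I N : nat) (d : 'I_I -> nat).
Variables (Rs : set 'rV[R]_I) (S : forall i : 'I_I, 'I_N -> 'M[R]_(d i)).

Lemma SlinE i (J : finType) (a : J -> R) (f : J -> 'cV[R]_N) :
  Slin S i (\sum_k a k *: f k) = \sum_k a k *: Slin S i (f k).
Proof.
rewrite /Slin; under [RHS]eq_bigr do rewrite scaler_sumr.
rewrite exchange_big; apply: eq_bigr => j _ /=.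
rewrite summxE scaler_suml; apply: eq_bigr => k _.
by rewrite !mxE scalerA.
Qed.

Lemma SlinZ i a g : Slin S i (a *: g) = a *: Slin S i g.
Proof.
by rewrite /Slin scaler_sumr; apply: eq_bigr => j _; rewrite mxE scalerA.
Qed.

Lemma Squad_outer i g : Squad S i (g *m g^T) = Slin S i g *m Slin S i g.
Proof.
rewrite /Squad /Slin mulmx_suml; apply: eq_bigr => p _.
rewrite mulmx_sumr; apply: eq_bigr => q _.
by rewrite -scalemxAl -scalemxAr scalerA !mxE big_ord1 !mxE.
Qed.

Lemma SquadD i G G' : Squad S i (G + G') = Squad S i G + Squad S i G'.
Proof.
rewrite /Squad -big_split; apply: eq_bigr => p _ /=.
by rewrite -big_split; apply: eq_bigr => q _ /=; rewrite mxE scalerDl.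
Qed.

Lemma SquadZ i a G : Squad S i (a *: G) = a *: Squad S i G.
Proof.
rewrite /Squad scaler_sumr; apply: eq_bigr => p _ /=.
by rewrite scaler_sumr; apply: eq_bigr => q _ /=; rewrite mxE scalerA.
Qed.

Lemma Squad0 i : Squad S i 0 = 0.
Proof. by rewrite -(scale0r 0) SquadZ scale0r. Qed.

Lemma Squad_sum i (J : finType) (G : J -> 'M[R]_N) :
  Squad S i (\sum_k G k) = \sum_k Squad S i (G k).
Proof.
elim/big_rec2: _ => [|k H G' _ <-]; [exact: Squad0 | exact: SquadD].
Qed.

(** Displays the form as linear in the entries of [G], for use in the continuity argument. *)
Lemma bform_Squad i G x : bform (Squad S i G) x x =
  \sum_p \sum_q G p q * bform (S i p *m S i q) x x.
Proof.
rewrite /bform mulmx_sumr mulmx_suml summxE; apply: eq_bigr => p _.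
rewrite mulmx_sumr mulmx_suml summxE; apply: eq_bigr => q _.
by rewrite -scalemxAr -scalemxAl mxE.
Qed.

Hypothesis data : spectratopic_data Rs S.

Lemma Slin_sym i g : (Slin S i g)^T = Slin S i g.
Proof.
rewrite linear_sum; apply: eq_bigr => j _; rewrite linearZ /=.
by rewrite (symmetricmxP _ (data_sym data i j)).
Qed.

Lemma Squad_sym i G : G^T = G -> (Squad S i G)^T = Squad S i G.
Proof.
move=> sG; rewrite /Squad linear_sum /= [RHS]exchange_big.
apply: eq_bigr => p _ /=; rewrite linear_sum; apply: eq_bigr => q _ /=.
rewrite linearZ /= trmx_mul !(symmetricmxP _ (data_sym data i _)).
by rewrite -{1}sG mxE.
Qed.

Lemma Rs_conv r r' (a b : R) : Rs r -> Rs r' -> 0 <= a -> 0 <= b -> a + b = 1 ->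
  Rs (a *: r + b *: r').
Proof.
move=> Rr Rr' a0 b0 ab; have a1 : a <= 1 by rewrite -ab lerDl.
have := data_convex data (Itv01 a0 a1) (mem_set Rr) (mem_set Rr').
rewrite inE => h; have -> : b = 1 - a by rewrite -ab addrC addKr.
exact: h.
Qed.

Lemma cone0 : spectratope_cone Rs S (0, 0).
Proof.
have [r /nbhs_singleton Rr] := data_interior data.
split => //=; [exact: psd0 | exists r => // i].
by rewrite Squad0 mul0r /loewner_le subr0; exact: psd_scalar.
Qed.

Lemma coneZ (t : R) (G : 'M[R]_N) (rho : R) : 0 <= t ->
  spectratope_cone Rs S (G, rho) ->
  spectratope_cone Rs S (t *: G, t * rho).
Proof.
move=> t0 [/= pG rho0 [r Rr Gr]]; split => /=; first exact: psdZ.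
  exact: mulr_ge0.
exists r => // i; rewrite SquadZ -mulrA /loewner_le -scale_scalar_mx -scalerBr.
exact: psdZ (Gr i).
Qed.

(** The witness for the sum is the average of r and r' with weights proportional to rho and rho'. *)
Lemma coneD (G G' : 'M[R]_N) (rho rho' : R) :
  spectratope_cone Rs S (G, rho) -> spectratope_cone Rs S (G', rho') ->
  spectratope_cone Rs S (G + G', rho + rho').
Proof.
move=> [/= pG rho0 [r Rr Gr]] [/= pG' rho0' [r' Rr' Gr']].
split => /=; [exact: psdD | exact: addr_ge0 |].
suff [r2 Rr2 E] : exists2 r2, Rs r2 &
    forall i, (rho + rho') * r2 0 i = rho * r 0 i + rho' * r' 0 i.
  exists r2 => // i; rewrite /loewner_le E SquadD raddfD /= opprD addrACA.
  exact: psdD (Gr i) (Gr' i).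
(* If the total is 0 then both scalars vanish and r itself serves. *)
have [s0|s0] := eqVneq (rho + rho') 0.
  have [-> ->] : rho = 0 /\ rho' = 0.
    by move/eqP: s0; rewrite paddr_eq0 // => /andP[/eqP ? /eqP].
  by exists r => // i; rewrite addr0 !mul0r addr0.
have s_ge0 : 0 <= (rho + rho')^-1 by rewrite invr_ge0 addr_ge0.
exists ((rho / (rho + rho')) *: r + (rho' / (rho + rho')) *: r').
  apply: Rs_conv => //; rewrite ?mulr_ge0 //.
  by rewrite -mulrDl divff.
by move=> i; rewrite !mxE; field.
Qed.

Lemma cone_sum m (lambda : 'I_m -> R) (g : 'I_m -> 'cV[R]_N) :
  (forall j, 0 <= lambda j) -> (forall j, spectratope Rs S (g j)) ->
  spectratope_cone Rs S
    (\sum_(j < m) lambda j *: (g j *m (g j)^T), \sum_(j < m) lambda j).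
Proof.
move=> l0 Hg.
have cone1 j : spectratope_cone Rs S (lambda j *: (g j *m (g j)^T), lambda j).
  rewrite -[X in (_, X)]mulr1; apply: coneZ => //.
  have [r Rr gr] := Hg j; split => /=; [exact: psd_outer | exact: ler01 |].
  by exists r => // i; rewrite Squad_outer mul1r.
elim: m lambda g l0 Hg cone1 => [|m IHm] lambda g l0 Hg cone1.
  by rewrite !big_ord0; exact: cone0.
rewrite !big_ord_recr /=; apply: coneD; last exact: cone1.
by apply: (IHm (fun j => lambda (widen_ord (leqnSn m) j))
               (fun j => g (widen_ord (leqnSn m) j))).
Qed.

Lemma cone_convex :
  @convex_set R ('M[R]_N * R^o)%type (spectratope_cone Rs S).
Proof.
move=> [G rho] [G' rho'] t; rewrite !inE => KG KG'.
have t0 : 0 <= t%:num by [].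
have t1 : 0 <= 1 - t%:num by rewrite subr_ge0.
exact: coneD (coneZ t0 KG) (coneZ t1 KG').
Qed.

(** * Closedness of the cone *)

Lemma continuous_sum_coord (T : topologicalType) n m (M : T -> 'M[R]_(n, m))
    (c : 'I_n -> 'I_m -> R) : continuous M ->
  continuous (fun p => \sum_i \sum_j M p i j * c i j : R).
Proof.
move=> cM p.
have csum (J : Type) (s : seq J) (f : J -> T -> R) :
    (forall j, f j q @[q --> p] --> f j p) ->
    \sum_(j <- s) f j q @[q --> p] --> \sum_(j <- s) f j p.
  move=> cf; elim: s => [|j s IHs].
    rewrite big_nil; under eq_fun do rewrite big_nil; exact: cvg_cst.
  by rewrite big_cons; under eq_fun do rewrite big_cons; exact: cvgD.
apply: (csum) => i; apply: (csum) => j.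
apply: cvgMl; apply: (@continuous_comp _ _ _ M (fun A : 'M[R]_(n, m) => A i j)).
  exact: cM.
exact: coord_continuous.
Qed.

(** Slack of the i-th semidefinite constraint tested at x. *)
Let bound i (x : 'cV[R]_(d i)) (r : 'rV[R]_I) (p : 'M[R]_N * R^o) : R :=
  p.2 * r 0 i * bform 1%:M x x - bform (Squad S i p.1) x x.

Lemma bound_continuous i (x : 'cV[R]_(d i)) :
  continuous (fun q : 'rV[R]_I * ('M[R]_N * R^o) => bound x q.1 q.2).
Proof.
pose M (q : 'rV[R]_I * ('M[R]_N * R^o)) := q.2.1.
have cM : continuous M.
  move=> q; apply: (@continuous_comp _ _ _ snd fst); first exact: cvg_snd.
  exact: cvg_fst.
have cS : continuous (fun q => bform (Squad S i (M q)) x x).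
  under eq_fun do rewrite bform_Squad.
  exact: continuous_sum_coord.
move=> q; apply: cvgB; last exact: cS.
apply: cvgMl; apply: cvgM.
  apply: (@continuous_comp _ _ _ snd snd); [exact: cvg_snd|exact: cvg_snd].
apply: (@continuous_comp _ _ _ fst (fun A : 'rV[R]_I => A 0 i)).
  exact: cvg_fst.
exact: coord_continuous.
Qed.

Lemma closed_ge0_family (T : topologicalType) (J : Type) (f : J -> T -> R) :
  (forall j, continuous (f j)) ->
  closed [set p | forall j, 0 <= f j p].
Proof.
move=> cf.
have -> : [set p | forall j, 0 <= f j p] =
          \bigcap_(j in [set: J]) (f j @^-1` [set y | 0 <= y]).
  by apply/seteqP; split => p /= fp j => [_|]; exact: fp.
apply: closed_bigI => j _; apply: (@closed_comp _ _ (f j)).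
  by move=> p _; exact: cf.
exact: closed_ge.
Qed.

(** All conditions are nonnegativity of continuous functions; the existential over r is a projection
    along the compact set [Rs], which preserves closedness. *)
Lemma cone_closed : closed (spectratope_cone Rs S).
Proof.
pose fst_M (p : 'M[R]_N * R^o) := p.1.
have cfst : continuous (fst_M) by move=> p; exact: cvg_fst.
have -> : spectratope_cone Rs S =
  (* Symmetry as inequalities: both orders of each index pair occur. *)
  [set p | forall ij : 'I_N * 'I_N, 0 <= fst_M p ij.1 ij.2 - fst_M p ij.2 ij.1] `&`
  [set p | forall x : 'cV[R]_N,
     0 <= \sum_i \sum_j fst_M p i j * (x i 0 * x j 0)] `&`
  [set p | forall u : unit, 0 <= p.2] `&`
  [set p | exists2 r, Rs r & forall i x, 0 <= bound (i := i) x r p].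
  have bformE (G : 'M[R]_N) x :
      bform G x x = \sum_i \sum_j G i j * (x i 0 * x j 0).
    rewrite /bform -mulmxA mxE; apply: eq_bigr => i _.
    rewrite !mxE mulr_sumr; apply: eq_bigr => j _; ring.
  apply/seteqP; split => [[G rho] /= [pG rho0 [r Rr Gr]]|[G rho] /=].
    split; last first.
      exists r => // i x; rewrite /bound /= -bform_scalar -bform_oppm -bform_addm.
      exact: psd_bform (Gr i).
    split; last by [].
    split => [[i j]|x] /=; last by rewrite -bformE psd_bform.
    have /= := congr1 (fun A : 'M[R]_N => A j i) (psd_sym pG).
    by rewrite mxE /fst_M /= => ->; rewrite subrr.
  move=> [[[sG qG] /(_ tt) rho0] [r Rr Gr]].
  have symG : G^T = G.
    apply/matrixP => i j; rewrite mxE; apply/eqP; rewrite eq_le.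
    by rewrite -subr_ge0 (sG (i, j)) -subr_ge0 (sG (j, i)).
  split => //=; first by apply: psdP => // x; rewrite bformE.
  exists r => // i; apply: psdP => [|x].
    by rewrite linearB /= tr_scalar_mx Squad_sym.
  rewrite bform_addm bform_oppm bform_scalar; exact: Gr.
apply: closedI; first (apply: closedI; first apply: closedI).
- apply: closed_ge0_family => -[i j] p /=; apply: cvgB.
    by apply: (@continuous_comp _ _ _ fst_M (fun A : 'M[R]_N => A i j));
      [exact: cfst|exact: coord_continuous].
  by apply: (@continuous_comp _ _ _ fst_M (fun A : 'M[R]_N => A j i));
    [exact: cfst|exact: coord_continuous].
- by apply: closed_ge0_family => x; exact: continuous_sum_coord.
- by apply: closed_ge0_family => _ p; exact: cvg_snd.
(* Tube argument on the complement: each r in [Rs] has a test vector with negative slack, which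
   stays negative near (r, p), and compactness gives one neighbourhood of p for all r. *)
rewrite -openC openE => p /= /forall2NP np.
have ncov := (compact_near_coveringP Rs).1 (data_compact data) _ (nbhs p)
  (fun q r => exists i x, bound (i := i) x r q < 0) _.
have : \forall q \near p, Rs `<=` (fun r => exists i x, bound (i := i) x r q < 0).
  apply: ncov => r Rr; have [//|/existsNP [i /existsNP [x /negP]]] := np r.
  rewrite -ltNge => bx.
  have := cvgr_lt _ (@bound_continuous i x (r, p)) _ bx.
  case=> -[U V] [/= rU pV] UV; exists (U, V) => // -[r' q] [/= Ur Vq].
  by exists i, x; exact: (UV (r', q)).
apply: filterS => q Rq [r Rr br]; have [i [x]] := Rq _ Rr.
by rewrite ltNge br.
Qed.

Lemma cone_closed_convex : closed_convex_cone (spectratope_cone Rs S).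
Proof.
split; [exact: cone_closed | exact: cone_convex | by exists (0, 0); exact: cone0 |].
by move=> t [G rho] t0; exact: coneZ.
Qed.

End Cone.

(** * The sampling program and its semantics *)

Section Cholesky.
Variables (R : realType) (N : nat).
Implicit Types (A : 'M[R]_N) (k : 'I_N).

Definition chol_col A k : 'cV[R]_N := \col_i (A i k / Num.sqrt (A k k)).

Definition chol_res A k : 'M[R]_N := A - chol_col A k *m (chol_col A k)^T.

Lemma psd_diag_ge0 A k : psd A -> 0 <= A k k.
Proof. by move=> pA; rewrite -bform_delta psd_bform. Qed.

Lemma chol_resE A k i j : psd A ->
  chol_res A k i j = A i j - A i k * A j k / A k k.
Proof.
move=> pA; rewrite !mxE big_ord1 !mxE; congr (_ - _).
by rewrite mulrACA -invfM -expr2 sqr_sqrtr // psd_diag_ge0.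
Qed.

(* If A k k = 0 then column k of A vanishes, and so does [chol_col A k] since
   x / 0 = 0. *)
Lemma psd_chol_res A k : psd A -> psd (chol_res A k).
Proof.
move=> pA; apply: psdP => [|x].
  by rewrite linearB /= psd_sym // trmx_mul trmxK.
rewrite bform_addm bform_oppm subr_ge0.
(* The subtracted form is (x^T A e_k)^2 / A_kk, which Cauchy-Schwarz bounds by x^T A x. *)
have -> : bform (chol_col A k *m (chol_col A k)^T) x x =
    bform A x (delta_mx k 0) ^+ 2 / A k k.
  have fE : x^T *m chol_col A k =
      (Num.sqrt (A k k))^-1 *: (x^T *m A *m delta_mx k 0).
    rewrite -mulmxA scalemxAr; congr (_ *m _).
    by apply/matrixP => i j; rewrite -colE !mxE mulrC.
  rewrite /bform mulmxA fE -mulmxA -[_^T *m x]trmxK trmx_mul trmxK fE.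
  rewrite !mxE big_ord1 !mxE mulrACA -invfM -expr2 sqr_sqrtr ?psd_diag_ge0 //.
  by rewrite -expr2 mulrC.
have := psd_cauchy_schwarz x (delta_mx k 0) pA; rewrite bform_delta.
have [k0|k0] := eqVneq (A k k) 0.
  by move=> _; rewrite k0 invr0 mulr0 psd_bform.
by rewrite ler_pdivrMr // lt_neqAle eq_sym k0 psd_diag_ge0.
Qed.

Lemma chol_res_col A k i : psd A -> chol_res A k i k = 0.
Proof.
move=> pA; rewrite chol_resE //; have [k0|k0] := eqVneq (A k k) 0.
  by rewrite k0 invr0 !mulr0 subr0 psd_diag0.
by rewrite mulfK // subrr.
Qed.

(** Columns eliminated earlier stay zero in later rounds. *)
Lemma chol_res_col0 A k l : psd A -> (forall i, A i l = 0) ->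
  forall i, chol_res A k i l = 0.
Proof.
move=> pA l0 i; rewrite chol_resE // l0 sub0r.
have -> : A l k = 0 by rewrite -(psd_sym pA) mxE l0.
by rewrite mulr0 mul0r oppr0.
Qed.

End Cholesky.

(* Index variables 2, 3, 4 are loop counters.  Array 0 holds the Cholesky
   residual and array 5 the Cholesky factor. *)
Definition chol_prog : cmd :=
  For 2 (IVar 0)
    (Seq
      (For 3 (IVar 0)
        (Store 5 (IVar 3) (IVar 2)
          (RDiv (RLoad 0 (IVar 3) (IVar 2))
                (RSqrt (RLoad 0 (IVar 2) (IVar 2))))))
      (For 3 (IVar 0)
        (For 4 (IVar 0)
          (Store 0 (IVar 3) (IVar 4)
            (RSub (RLoad 0 (IVar 3) (IVar 4))
                  (RMul (RLoad 5 (IVar 3) (IVar 2))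
                        (RLoad 5 (IVar 4) (IVar 2)))))))).

Definition kappa_rho_expr : rexp :=
  RMul
    (RMul (RNat (INum 4))
      (RLn (RMul (RMul (RNat (INum 4)) (RNat (IVar 1))) (RNat (IVar 0)))))
    (RLoad 1 (INum 0) (INum 0)).

Definition dct_expr (k j : iexp) : rexp :=
  let odd_index i := IAdd (IMul (INum 2) i) (INum 1) in
  RMul (RSqrt (RDiv (RNat (INum 2)) (RNat (IVar 0))))
    (RCos (RDiv (RMul RPi (RNat (IMul (odd_index j) (odd_index k))))
                (RNat (IMul (INum 4) (IVar 0))))).

(** Variables 2, 3 and 4 hold the output column j, the row p and the summation index k. *)
Definition mix_term : rexp :=
  RMul
    (RMul (RSub (RMul (RNat (INum 2)) (RBit (IVar 4))) (RNat (INum 1)))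
          (dct_expr (IVar 4) (IVar 2)))
    (RMul (RLoad 5 (IVar 3) (IVar 4))
          (RSqrt (RDiv (RNat (IVar 0)) kappa_rho_expr))).

Definition mix_prog : cmd :=
  For 2 (IVar 0)
    (Seq
      (Store 2 (IVar 2) (INum 0) (RDiv kappa_rho_expr (RNat (IVar 0))))
      (For 3 (IVar 0)
        (For 4 (IVar 0)
          (Store 3 (IVar 3) (IVar 2)
            (RAdd (RLoad 3 (IVar 3) (IVar 2)) mix_term))))).

(** The tape has N bits, one sign per Cholesky column. *)
Definition sampler : algorithm := Algorithm (IVar 0) (Seq chol_prog mix_prog).

(** Loops nest to depth three with constant-size bodies, hence a cubic bound; 200 absorbs the
    operation counts. *)
Lemma polynomial_time_sampler : polynomial_time sampler.
Proof.
exists 200%N, 3%N => N D; set M := (N + D).+1.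
rewrite /= /iupd /sizes /= !big_const_ord !iter_addn_0.
have NM : (N <= M)%N by rewrite /M; lia.
have M1 : (0 < M)%N by [].
have M2 : (N * N <= M ^ 2)%N by rewrite expnS expn1 leq_mul.
have M3 : (N * N * N <= M ^ 3)%N by rewrite !expnS expn0 muln1 mulnA !leq_mul.
have M12 : (M <= M ^ 2)%N by rewrite expnS expn1 leq_pmulr.
have M23 : (M ^ 2 <= M ^ 3)%N by rewrite leq_pexp2l.
move: M12 M23 M3 M2 NM M1; set a := (M ^ 3)%N; set b := (M ^ 2)%N => *.
lia.
Qed.

(** * Loop invariants for the two phases of the program *)

Section Semantics.
Variable R : realType.
Implicit Type s : store R.

Lemma run_seq w e c1 c2 s : run w e (Seq c1 c2) s = run w e c2 (run w e c1 s).
Proof. by []. Qed.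

Lemma run_for_ind (P : nat -> store R -> Prop) w e v x c s :
  P 0%N s ->
  (forall k s', (k < ieval e x)%N -> P k s' ->
     P k.+1 (run w (iupd e v k) c s')) ->
  P (ieval e x) (run w e (For v x c) s).
Proof.
move=> P0 PS /=; set n := ieval e x in PS *.
suff main m : (m <= n)%N ->
    P m (foldl (fun s' k => run w (iupd e v k) c s') s (iota 0 m)) by exact: main.
elim: m => [|m IHm] mn //.
by rewrite -addn1 iotaD add0n foldl_cat addn1; apply: PS => //; apply/IHm/ltnW.
Qed.

Section Phases.
Variables (N D : nat).
Let e0 := sizes N D.

Lemma run_chol_col w k s a i j :
  run w (iupd e0 2 k)
    (For 3 (IVar 0)
      (Store 5 (IVar 3) (IVar 2)
        (RDiv (RLoad 0 (IVar 3) (IVar 2))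
              (RSqrt (RLoad 0 (IVar 2) (IVar 2)))))) s a i j =
  if [&& a == 5%N, (i < N)%N & j == k] then s 0%N i k / Num.sqrt (s 0%N k k)
  else s a i j.
Proof.
move: a i j.
apply: (@run_for_ind (fun m s' => forall a i j, s' a i j =
  if [&& a == 5%N, (i < m)%N & j == k] then s 0%N i k / Num.sqrt (s 0%N k k)
  else s a i j)) => [a i j|m s' _ IH a i j] /=.
  by rewrite ?ltn0 ?andbF.
rewrite /supd /iupd /= !IH /= [(i < m.+1)%N]ltnS [(i <= m)%N]leq_eqVlt.
case: (a =P 5%N) => [->|_] //=; case: (i =P m) => [->|_] //=.
by case: (j == k); rewrite ?andbF.
Qed.

(** The in-place update is safe: each entry of array 0 is read only in the iteration that rewrites
    it, and array 5 is not written. *)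
Lemma run_chol_sub w k s a i j :
  run w (iupd e0 2 k)
    (For 3 (IVar 0)
      (For 4 (IVar 0)
        (Store 0 (IVar 3) (IVar 4)
          (RSub (RLoad 0 (IVar 3) (IVar 4))
                (RMul (RLoad 5 (IVar 3) (IVar 2))
                      (RLoad 5 (IVar 4) (IVar 2))))))) s a i j =
  if [&& a == 0%N, (i < N)%N & (j < N)%N]
  then s 0%N i j - s 5%N i k * s 5%N j k else s a i j.
Proof.
move: a i j.
apply: (@run_for_ind (fun m s' => forall a i j, s' a i j =
  if [&& a == 0%N, (i < m)%N & (j < N)%N]
  then s 0%N i j - s 5%N i k * s 5%N j k else s a i j)) => [a i j|m s' _ IH].
  by rewrite /= ?ltn0 ?andbF.
have inner := @run_for_ind (fun n s2 => forall a i j, s2 a i j =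
  if [&& a == 0%N, i == m & (j < n)%N]
  then s 0%N m j - s 5%N m k * s 5%N j k else s' a i j) w
  (iupd (iupd e0 2 k) 3 m) 4 (IVar 0) _ s'.
move=> a i j; rewrite inner => [|{}a {}i {}j|n s2 _ IH2 {}a {}i {}j] /=.
- rewrite IH [(i < m.+1)%N]ltnS [(i <= m)%N]leq_eqVlt.
  case: (a =P 0%N) => [->|_] //=; case: (i =P m) => [->|_] //=. by rewrite ltnn.
- by rewrite ?ltn0 ?andbF.
rewrite /supd /iupd /= !IH2 /= !IH /= ltnn /= !andbF.
rewrite [(j < n.+1)%N]ltnS [(j <= n)%N]leq_eqVlt.
case: (a =P 0%N) => [->|_] //=; case: (i =P m) => [->|_] //=.
by rewrite ltnn /=; case: (j =P n) => [->|_].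
Qed.

Definition mx_of s a : 'M[R]_N := \matrix_(i, j) s a i j.

Lemma run_chol_prog w s : psd (mx_of s 0%N) ->
  let s1 := run w e0 chol_prog s in
  \sum_k col k (mx_of s1 5%N) *m (col k (mx_of s1 5%N))^T = mx_of s 0%N /\
  (forall a i j, a != 0%N -> a != 5%N -> s1 a i j = s a i j).
Proof.
move=> pA.
(* After m rounds the residual is positive semidefinite with m zero columns, and adding the outer
   products found so far restores the input. At m = N the residual is 0. *)
pose P m s1 := [/\ psd (mx_of s1 0%N),
    forall k : 'I_N, (k < m)%N -> forall i, mx_of s1 0%N i k = 0,
    mx_of s 0%N = mx_of s1 0%N +
      \sum_(k < N | (k < m)%N) col k (mx_of s1 5%N) *m (col k (mx_of s1 5%N))^T &
    forall a i j, a != 0%N -> a != 5%N -> s1 a i j = s a i j].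
suff [] : P N (run w e0 chol_prog s).
  move=> _ A0 As same; split => //; rewrite As.
  have -> : mx_of (run w e0 chol_prog s) 0%N = 0.
    by apply/matrixP => i k; rewrite A0 // mxE.
  by rewrite add0r; apply: eq_bigl => k; rewrite ltn_ord.
apply: (@run_for_ind P w e0 2 (IVar 0)) => [|m s1 mN [pA1 A10 As same]].
  split => //; rewrite big_pred0 ?addr0 // => k; by rewrite ltn0.
pose k := Ordinal (mN : (m < N)%N).
set s2 := run _ _ _ _.
have s2E a i j : s2 a i j = if [&& a == 0%N, (i < N)%N & (j < N)%N]
    then s1 0%N i j - s1 0%N i k / Num.sqrt (s1 0%N k k) *
                     (s1 0%N j k / Num.sqrt (s1 0%N k k))
    else if [&& a == 5%N, (i < N)%N & j == k]
    then s1 0%N i k / Num.sqrt (s1 0%N k k) else s1 a i j.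
  rewrite /s2 run_seq.
  rewrite run_chol_sub !run_chol_col /= eqxx andbT.
  by case: (a =P 0%N) => [->|_] //=; case: ltnP => //= iN; case: ltnP.
have s20 : mx_of s2 0%N = chol_res (mx_of s1 0%N) k.
  apply/matrixP => i j; rewrite /chol_res !mxE big_ord1 !mxE s2E /= !ltn_ord.
  by [].
have s25 l : col l (mx_of s2 5%N) =
    if l == k then chol_col (mx_of s1 0%N) k else col l (mx_of s1 5%N).
  apply/matrixP => i j; rewrite !mxE s2E /= ltn_ord /=.
  rewrite -val_eqE /=; case: (l =P m :> nat) => _; by rewrite !mxE.
split.
- by rewrite s20; exact: psd_chol_res.
- move=> l; rewrite ltnS leq_eqVlt s20 => /orP[/eqP lm i|lm].
    have -> : l = k by exact: val_inj.
    exact: chol_res_col.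
  by apply: chol_res_col0 => //; exact: A10.
- rewrite As s20 [X in _ = _ + X](bigD1 k) //= s25 eqxx addrA subrK; congr (_ + _).
  apply: eq_big => [l|l lm].
    by rewrite ltnS ltn_neqAle andbC -val_eqE.
  by rewrite s25 -val_eqE /= ltn_eqF.
- move=> a i j a0 a5; rewrite s2E (negPf a0) (negPf a5) /=; exact: same.
Qed.

Definition kappa_rho s : R := 4 * ln (4 * D%:R * N%:R) * s 1%N 0%N 0%N.

Definition mix_val (w : nat -> bool) s (p j k : nat) : R :=
  sign R (w k) * dct R N k j * (s 5%N p k * Num.sqrt (N%:R / kappa_rho s)).

Lemma run_mix_entry w j p s a i j' :
  run w (iupd (iupd e0 2 j) 3 p)
    (For 4 (IVar 0)
      (Store 3 (IVar 3) (IVar 2)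
        (RAdd (RLoad 3 (IVar 3) (IVar 2)) mix_term))) s a i j' =
  if [&& a == 3%N, i == p & j' == j]
  then s 3%N p j + \sum_(k < N) mix_val w s p j k else s a i j'.
Proof.
move: a i j'.
apply: (@run_for_ind (fun m s' => forall a i j', s' a i j' =
  if [&& a == 3%N, i == p & j' == j]
  then s 3%N p j + \sum_(k < m) mix_val w s p j k else s a i j'))
  => [a i j'|m s' _ IH a i j'].
  rewrite big_ord0 addr0.
  case: (a =P 3%N) => [->|_] //=; case: (i =P p) => [->|_] //=.
  by case: (j' =P j) => [->|_].
rewrite /= /supd /iupd /= !IH /= !eqxx /=; case: ifP => [_|->] //.
by rewrite big_ord_recr /= addrA.
Qed.

Lemma run_mix_column w j s a i j' :
  run w (iupd e0 2 j)
    (For 3 (IVar 0)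
      (For 4 (IVar 0)
        (Store 3 (IVar 3) (IVar 2)
          (RAdd (RLoad 3 (IVar 3) (IVar 2)) mix_term)))) s a i j' =
  if [&& a == 3%N, (i < N)%N & j' == j]
  then s 3%N i j + \sum_(k < N) mix_val w s i j k else s a i j'.
Proof.
move: a i j'.
apply: (@run_for_ind (fun m s' => forall a i j', s' a i j' =
  if [&& a == 3%N, (i < m)%N & j' == j]
  then s 3%N i j + \sum_(k < N) mix_val w s i j k else s a i j'))
  => [a i j'|m s' _ IH a i j'].
  by rewrite /= ?ltn0 ?andbF.
rewrite run_mix_entry !IH [(i < m.+1)%N]ltnS [(i <= m)%N]leq_eqVlt /= ltnn /=.
case: (a =P 3%N) => [->|_] //=; case: (i =P m) => [->|_] //=.
rewrite ltnn /=; case: (j' == j) => //; congr (_ + _); apply: eq_bigr => k _.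
by rewrite /mix_val /kappa_rho !IH.
Qed.

Lemma run_mix_prog w s :
  let s1 := run w e0 mix_prog s in
  (forall j, (j < N)%N -> s1 2%N j 0%N = kappa_rho s / N%:R) /\
  (forall i j, (i < N)%N -> (j < N)%N ->
     s1 3%N i j = s 3%N i j + \sum_(k < N) mix_val w s i j k).
Proof.
(* Besides the finished columns, the invariant records what later rounds read: the untouched columns
   of array 3, array 5, and rho. *)
pose P m s1 := [/\
    forall j, (j < m)%N -> s1 2%N j 0%N = kappa_rho s / N%:R,
    forall i j, (i < N)%N -> (j < m)%N ->
      s1 3%N i j = s 3%N i j + \sum_(k < N) mix_val w s i j k,
    forall i j, (m <= j)%N -> s1 3%N i j = s 3%N i j,
    forall i j, s1 5%N i j = s 5%N i j &
    s1 1%N 0%N 0%N = s 1%N 0%N 0%N].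
suff [] : P N (run w e0 mix_prog s) by [].
apply: (@run_for_ind P w e0 2 (IVar 0)) => [|m s1 mN [s12 s13 s13' s15 s11]].
  by split.
set s2 := run _ _ _ _.
have s2E a i j : s2 a i j =
    if [&& a == 3%N, (i < N)%N & j == m]
    then s1 3%N i m + \sum_(k < N) mix_val w s i m k
    else if [&& a == 2%N, i == m & j == 0%N] then kappa_rho s / N%:R
    else s1 a i j.
  rewrite /s2 run_seq.
  rewrite run_mix_column /= /supd /iupd /=.
  have -> : (4%:R * ln (4%:R * D%:R * N%:R) * s1 1%N 0%N 0%N) = kappa_rho s.
    by rewrite /kappa_rho s11.
  case: ifP => // _; congr (_ + _); apply: eq_bigr => k _.
  by rewrite /mix_val /kappa_rho /= s15 s11.
split.
- move=> j; rewrite ltnS leq_eqVlt s2E /= eqxx andbT.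
  by case: (j =P m) => [->|_] //= /s12.
- move=> i j iN; rewrite ltnS leq_eqVlt s2E /= iN /=.
  by case: (j =P m) => [->|_] /=; [rewrite s13'|move=> /(s13 _ _ iN)].
- by move=> i j mj; rewrite s2E /= gtn_eqF // andbF s13' // ltnW.
- by move=> i j; rewrite s2E /= s15.
- by rewrite s2E /= s11.
Qed.

End Phases.
End Semantics.

(** * Correctness of the sampler *)

Section Sampling.
Variable R : realType.

Lemma ln_natr_ge0 n : 0 <= ln (n%:R : R).
Proof. by case: n => [|n]; [rewrite ln0 | rewrite ln_ge0 // ler1n]. Qed.

Section Mixing.
Variables (N : nat) (F : 'M[R]_N).
Implicit Type w : N.-tuple bool.

Definition mixed w (j : 'I_N) : 'cV[R]_N :=
  \sum_(k < N) (sign R (tnth w k) * dct R N k j) *: col k F.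

(** Orthonormality of the DCT rows removes the cross terms k != l, and in the diagonal terms the
    signs square to 1. *)
Lemma sum_mixed_outer w :
  \sum_j mixed w j *m (mixed w j)^T = \sum_k col k F *m (col k F)^T.
Proof.
have expand j : mixed w j *m (mixed w j)^T = \sum_k \sum_l
    (sign R (tnth w k) * sign R (tnth w l) * (dct R N k j * dct R N l j)) *:
    (col k F *m (col l F)^T).
  rewrite /mixed mulmx_suml; apply: eq_bigr => k _.
  rewrite linear_sum mulmx_sumr; apply: eq_bigr => l _ /=.
  by rewrite linearZ /= -scalemxAl -scalemxAr scalerA mulrACA.
under eq_bigr do rewrite expand.
rewrite exchange_big; apply: eq_bigr => k _ /=.
rewrite exchange_big (bigD1 k) //= [X in _ + X]big1 ?addr0 => [|l lk].
  by rewrite -scaler_suml -mulr_sumr dct_orthonormal // eqxx mulr1 sign_sqr scale1r.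
rewrite -scaler_suml -mulr_sumr dct_orthonormal //.
by rewrite val_eqE eq_sym (negPf lk) mulr0 scale0r.
Qed.

End Mixing.

Variables (I N : nat) (d : 'I_I -> nat).
Variables (Rs : set 'rV[R]_I) (S : forall i : 'I_I, 'I_N -> 'M[R]_(d i)).
Hypothesis data : spectratopic_data Rs S.
Variables (Sigma : 'M[R]_N) (rho : R) (r : 'rV[R]_I) (F : 'M[R]_N).
Hypothesis rho_ge0 : 0 <= rho.
Hypothesis Rr : Rs r.
Hypothesis Sigma_le : forall i, loewner_le (Squad S i Sigma) (rho * r 0 i)%:M.
Hypothesis factor : \sum_k col k F *m (col k F)^T = Sigma.
Implicit Type w : N.-tuple bool.

Let D := total_dim d.
Let A i (j k : 'I_N) : 'M[R]_(d i) := dct R N k j *: Slin S i (col k F).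
Let v i : R := 2 / N%:R * (rho * r 0 i).
Let y : R := 2 * ln (4 * D%:R * N%:R).
Let kap : R := kappa R N d.

Lemma Slin_mixed i w j : Slin S i (mixed F w j) = rademacher (A i j) w.
Proof. by rewrite /mixed SlinE; apply: eq_bigr => k _; rewrite scalerA. Qed.

Lemma A_sym i j k : (A i j k)^T = A i j k.
Proof. by rewrite linearZ /= (Slin_sym data). Qed.

Lemma v_ge0 i : 0 <= v i.
Proof. by rewrite !mulr_ge0 ?invr_ge0 // (data_nonneg data). Qed.

(** The gap splits into 2/N times the slack of the cone constraint, plus squares weighted by the
    slack in the bound 2/N on squared DCT entries. *)
Lemma variance_le i j : psd ((v i)%:M - \sum_k A i j k * A i j k).
Proof.
have -> : (v i)%:M - \sum_k A i j k * A i j k =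
    (2 / N%:R) *: ((rho * r 0 i)%:M - Squad S i Sigma) +
    \sum_(k < N) (2 / N%:R - dct R N k j ^+ 2) *:
      ((Slin S i (col k F))^T *m Slin S i (col k F)).
  rewrite -factor Squad_sum scalerBr scale_scalar_mx -/(v i) -addrA.
  congr (_ + _); rewrite scaler_sumr -!sumrN -big_split.
  apply: eq_bigr => k _ /=.
  rewrite Squad_outer (Slin_sym data) scalerBl addrA addNr add0r.
  by rewrite /A scalemxMl scalemxMr scalerA -expr2.
apply: psdD; first by apply: psdZ (Sigma_le i); rewrite divr_ge0.
apply: psd_sum => k _; apply: psdZ; last exact: psd_gram.
by rewrite subr_ge0 dct_sqr_le.
Qed.

Definition good w : bool :=
  [forall i, [forall j, ~~ exceeds (A i j) (y * v i) w]].

Lemma goodP w i j : good w ->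
  psd ((y * v i)%:M - rademacher (A i j) w * rademacher (A i j) w).
Proof. by move=> /forallP /(_ i) /forallP /(_ j); rewrite negbK => /asboolP. Qed.

Lemma y_ge0 : 0 <= y.
Proof. by rewrite mulr_ge0 // -!natrM ln_natr_ge0. Qed.

Lemma kappa2y : kap = 2 * y.
Proof. by rewrite /kap /kappa /y -/D; ring. Qed.

(** Nondegeneracy at the all-ones vector yields a nonzero matrix, which cannot have size 0. This
    makes 4DN > 1, hence kappa > 0. *)
Lemma total_dim_gt0 : (0 < N)%N -> (0 < D)%N.
Proof.
move=> N0; have [i Si] : exists i, Slin S i (const_mx 1) != 0.
  apply: (data_nondegenerate data); apply/eqP => /matrixP /(_ (Ordinal N0) 0).
  by rewrite !mxE => /eqP; rewrite oner_eq0.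
have di : (0 < d i)%N.
  rewrite lt0n; apply: contraNneq Si => d0; apply/eqP/matrixP => a.
  by case: a => a ai; exfalso; rewrite d0 in ai.
by rewrite /D /total_dim (bigD1 i) //= addn_gt0 di.
Qed.

(** Union bound: since exp(-y/2) = 1 / (4DN), each pair (i, j) spoils at most 2 d_i 2^N / (4DN)
    tapes, and summing over i and j gives 2^N / 2. *)
Lemma card_good : 2 ^+ N / 2 <= #|[pred w | good w]|%:R :> R.
Proof.
set B := fun i j => [pred w | exceeds (A i j) (y * v i) w].
have union : (#|[pred w | ~~ good w]| <= \sum_i \sum_j #|B i j|)%N.
  have cardE (P : pred (N.-tuple bool)) : #|P| = (\sum_w P w)%N.
    by rewrite -sum1_card big_mkcond.
  rewrite cardE; under [leqRHS]eq_bigr do under eq_bigr do rewrite cardE.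
  under [leqRHS]eq_bigr do rewrite exchange_big.
  rewrite exchange_big; apply: leq_sum => w _ /=.
  have [gw|/forallPn[i /forallPn[j]]] //= := boolP (good w).
  rewrite negbK => Bw.
  by rewrite (bigD1 i) //= (bigD1 j) //= Bw.
have total : (#|[pred w | good w]| + #|[pred w | ~~ good w]| = 2 ^ N)%N.
  have := cardC [pred w | good w]; rewrite card_tuple card_bool => <-.
  by congr (_ + _)%N; apply: eq_card => w; rewrite !inE.
suff : #|[pred w | ~~ good w]|%:R <= 2 ^+ N / 2 :> R.
  move/(congr1 (fun n => n%:R : R)): total; rewrite natrD natrX; lra.
apply: (@le_trans _ _ (\sum_i \sum_j #|B i j|)%:R); first by rewrite ler_nat.
have [N0|N0] := posnP N.
  rewrite big1 ?divr_ge0 ?exprn_ge0 // => i _; rewrite big1 // => -[j jN].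
  by exfalso; rewrite N0 in jN.
have D0 := total_dim_gt0 N0.
have DN : 0 < 4 * D%:R * N%:R :> R by rewrite !mulr_gt0 ?ltr0n.
have Bij i j : #|B i j|%:R <= 2 * ((d i)%:R * 2 ^+ N) / (4 * D%:R * N%:R) :> R.
  have := card_exceeds_le (A_sym i j) (v_ge0 i) (variance_le i j) y_ge0.
  by have -> : y / 2 = ln (4 * D%:R * N%:R);
    [rewrite /y; field | rewrite expRN lnK ?posrE].
apply: (@le_trans _ _
  (\sum_(i < I) \sum_(j < N) 2 * ((d i)%:R * 2 ^+ N) / (4 * D%:R * N%:R))).
  rewrite natr_sum; apply: ler_sum => i _; rewrite natr_sum; exact: ler_sum.
under eq_bigr do rewrite sumr_const card_ord.
rewrite le_eqVlt; apply/orP; left; apply/eqP.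
transitivity (\sum_(i < I) (d i)%:R * (2 * 2 ^+ N / (4 * D%:R * N%:R) * N%:R) : R).
  by apply: eq_bigr => i _; rewrite -mulr_natr; field; rewrite !pnatr_eq0 -!lt0n N0.
rewrite -mulr_suml -natr_sum -/(total_dim d) -/D.
by field; rewrite !pnatr_eq0 -!lt0n N0.
Qed.

Lemma good_decomposes w : good w ->
  decomposes (spectratope Rs S) Sigma (kap * rho)
    (fun=> kap * rho / N%:R)
    (fun j => Num.sqrt (N%:R / (kap * rho)) *: mixed F w j).
Proof.
move=> gw.
have kap_ge0 : 0 <= kap by rewrite kappa2y mulr_ge0 // y_ge0.
have kr_ge0 : 0 <= kap * rho by rewrite mulr_ge0.
have outer : \sum_j mixed F w j *m (mixed F w j)^T = Sigma.
  by rewrite sum_mixed_outer.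
have sumZ (a : R) : \sum_(j < N) (kap * rho / N%:R) *:
    ((a *: mixed F w j) *m (a *: mixed F w j)^T) =
    (kap * rho / N%:R * a ^+ 2) *: Sigma.
  rewrite -outer scaler_sumr; apply: eq_bigr => j _.
  by rewrite linearZ /= -scalemxAl -scalemxAr !scalerA expr2 mulrA.
split => [j| | |j].
- by rewrite divr_ge0.
- rewrite sumZ sqr_sqrtr ?divr_ge0 //.
  have [N0|N0] := posnP N.
    by apply/matrixP => i; case: i => i iN; exfalso; rewrite N0 in iN.
  have Nn0 : N%:R != 0 :> R by rewrite pnatr_eq0 -lt0n.
  have [rho0|rho0] := eqVneq rho 0; last first.
    suff kap0 : kap != 0.
      have -> : kap * rho / N%:R * (N%:R / (kap * rho)) = 1.
        by field; rewrite Nn0 rho0 kap0.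
      by rewrite scale1r.
    rewrite kappa2y !mulf_neq0 ?pnatr_eq0 // gt_eqF // ln_gt0 // -!natrM ltr1n.
    by have := total_dim_gt0 N0; nia.
  (* For rho = 0 the scale is 0 by the convention on division, so Sigma = 0 is needed: the threshold
     is 0, every S_i[h_j] vanishes, and nondegeneracy gives h_j = 0. *)
  rewrite rho0 mulr0 mul0r mul0r scale0r -outer big1 // => j _.
  suff -> : mixed F w j = 0 by rewrite mul0mx.
  apply: contrapT => /eqP /(data_nondegenerate data) [i /eqP]; apply.
  rewrite Slin_mixed; set X := rademacher _ _.
  have := goodP i j gw; rewrite /v rho0 !(mul0r, mulr0) -/X => pX.
  have sX : X^T = X by apply: rademacher_sym => k; exact: A_sym.
  apply/matrixP => a b; rewrite -(bform_delta X).
  have Xb : X *m (delta_mx b 0 : 'cV[R]_(d i)) = 0.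
    apply: bform1_eq0; rewrite -bform_conj sX mulmx1.
    have := psd_bform (delta_mx b 0) pX.
    by rewrite bform_addm bform_oppm bform_scalar mul0r sub0r oppr_ge0.
  by rewrite /bform -mulmxA Xb mulmx0 !mxE.
- rewrite sumr_const card_ord -[leLHS]mulr_natr.
  have [N0|N0] := posnP N; first by rewrite N0 mulr0.
  by rewrite divfK // pnatr_eq0 -lt0n.
- exists r => // i; rewrite SlinZ Slin_mixed; set X := rademacher _ _.
  set c := Num.sqrt _.
  have -> : (c *: X) *m (c *: X) = c ^+ 2 *: (X * X).
    by rewrite -scalemxAl -scalemxAr scalerA.
  rewrite /c sqr_sqrtr ?divr_ge0 //.
  (* Here the scaled vector is 0, which lies in the spectratope because r >= 0. *)
  have [k0|k0] := eqVneq (kap * rho) 0.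
    rewrite k0 invr0 mulr0 scale0r /loewner_le subr0; apply: psd_scalar.
    exact: (data_nonneg data).
  have := k0; rewrite mulf_eq0 negb_or => /andP[kn0 rhon0].
  have Nn0 : N%:R != 0 :> R.
    by rewrite pnatr_eq0 -lt0n; apply: leq_ltn_trans (ltn_ord j).
  have yn0 : y != 0 by move: kn0; rewrite kappa2y mulf_eq0 negb_or => /andP[].
  (* With kappa = 2y and v_i = 2 rho r_i / N, the scaling sends the tail threshold exactly to
     r_i. *)
  have -> : (r 0 i)%:M = (N%:R / (kap * rho)) *: (y * v i)%:M :> 'M[R]_(d i).
    rewrite scale_scalar_mx kappa2y /v; congr (_%:M).
    by field; rewrite Nn0 rhon0 yn0.
  rewrite /loewner_le -scalerBr; apply: psdZ; first by rewrite divr_ge0.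
  exact: goodP.
Qed.

End Sampling.

(** The program's output is identified with the decomposition of [good_decomposes], so every good
    tape succeeds, and at least half of the tapes are good. *)
Lemma sampler_success (R : realType) (I N : nat) (d : 'I_I -> nat)
    (Rs : set 'rV[R]_I) (S : forall i : 'I_I, 'I_N -> 'M[R]_(d i))
    (Sigma : 'M[R]_N) (rho : R) :
  spectratopic_data Rs S -> spectratope_cone Rs S (Sigma, rho) ->
  1 / 2 <= success_probability (total_dim d) sampler Sigma rho
             (decomposes (spectratope Rs S) Sigma (kappa R N d * rho)).
Proof.
move=> data [/= pS rho0 [r Rr Sr]].
set D := total_dim d.
pose s0 := input_store Sigma rho.
have inS : mx_of N s0 0%N = Sigma.
  by apply/matrixP => i j; rewrite mxE /s0 /= !valK.
(* The Cholesky phase reads no random bit. *)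
pose s1 := run (fun=> false) (sizes N D) chol_prog s0.
have [factor same] :
    \sum_k col k (mx_of N s1 5%N) *m (col k (mx_of N s1 5%N))^T = Sigma
    /\ (forall a i j, a != 0%N -> a != 5%N -> s1 a i j = s0 a i j).
  have := @run_chol_prog R N D (fun=> false) s0; rewrite inS; exact.
set F := mx_of N s1 5%N in factor.
have krE : kappa_rho N D s1 = kappa R N d * rho by rewrite /kappa_rho same.
have out w : run (nth false w) (sizes N D) (body sampler) s0 =
             run (nth false w) (sizes N D) mix_prog s1 by [].
rewrite /success_probability ler_pdivlMr ?exprn_gt0 // mul1r mulrC.
apply: (le_trans (card_good data rho0 Rr Sr factor)).
rewrite ler_nat; apply: subset_leq_card; apply/fintype.subsetP => w.
rewrite !inE => gw; apply/asboolP.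
have [lamE gE] := @run_mix_prog R N D (nth false w) s1.
have -> : @out_lambda R N D sampler Sigma rho w =
    (fun=> kappa R N d * rho / N%:R).
  by apply/funext => j; rewrite /out_lambda /final_store out -krE -(lamE j).
have -> : @out_g R N D sampler Sigma rho w =
    (fun j => Num.sqrt (N%:R / (kappa R N d * rho)) *: mixed F w j).
  apply/funext => j; apply/matrixP => p q.
  rewrite mxE /final_store out gE // same // add0r.
  rewrite /mixed !mxE summxE mulr_sumr; apply: eq_bigr => k _.
  rewrite /mix_val krE !mxE (tnth_nth false) /=; ring.
by apply/asboolP; exact: (good_decomposes data rho0 Rr factor gw).
Qed.

Theorem proposition2p4 (R : realType) :
  (forall (I N : nat) (d : 'I_I -> nat) (Rs : set 'rV[R]_I)
      (S : forall i : 'I_I, 'I_N -> 'M[R]_(d i)),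
    spectratopic_data Rs S ->
    [/\ closed_convex_cone (spectratope_cone Rs S),
        forall (m : nat) (lambda : 'I_m -> R) (g : 'I_m -> 'cV[R]_N),
          (forall j, 0 <= lambda j) ->
          (forall j, spectratope Rs S (g j)) ->
          spectratope_cone Rs S
            (\sum_(j < m) lambda j *: (g j *m (g j)^T), \sum_(j < m) lambda j)
      & forall (Sigma : 'M[R]_N) (rho : R),
          spectratope_cone Rs S (Sigma, rho) ->
          exists (lambda : 'I_N -> R) (g : 'I_N -> 'cV[R]_N),
            decomposes (spectratope Rs S) Sigma (kappa R N d * rho) lambda g]) /\
  (exists A : algorithm, polynomial_time A /\
    forall (I N : nat) (d : 'I_I -> nat) (Rs : set 'rV[R]_I)
      (S : forall i : 'I_I, 'I_N -> 'M[R]_(d i)),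
    spectratopic_data Rs S ->
    forall (Sigma : 'M[R]_N) (rho : R),
      spectratope_cone Rs S (Sigma, rho) ->
      1 / 2 <= success_probability (total_dim d) A Sigma rho
                 (decomposes (spectratope Rs S) Sigma (kappa R N d * rho))).
Proof.
split=> [I N d Rs S data|].
  split; [exact: cone_closed_convex | by move=> *; exact: cone_sum |].
  move=> Sigma rho K; have := sampler_success data K.
  rewrite /success_probability.
  (* Probabilistic method: if no tape succeeded, the success probability would be 0 rather than at
     least 1/2. *)
  have [w ww _|no] := pickP [pred w | `[< decomposes (spectratope Rs S) Sigma
      (kappa R N d * rho) (@out_lambda R N (total_dim d) sampler Sigma rho w)
      (@out_g R N (total_dim d) sampler Sigma rho w) >]].
    by move: ww; rewrite /= => /asboolP; eexists; eexists; eassumption.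
  by rewrite eq_card0 // mul0r; lra.
exists sampler; split; first exact: polynomial_time_sampler.
by move=> *; exact: sampler_success.
Qed.
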